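(* Let $V$ be a vector space over the discrete field $k$. For each cardinal $\kappa$ with $\aleph_0\leqslant\kappa\leqslant(\dim V)^+$ let $V_\kappa=(V,\tau_{V,\kappa})$ be $V$ with the $\kappa$-codimension topology. Then: 1. If $\aleph_0\leqslant\kappa,\kappa'\leqslant(\dim V)^+$ and $\kappa\neq\kappa'$, then $V_\kappa$ and $V_{\kappa'}$ are not isomorphic as topological vector spaces. 2. If $\aleph_0\leqslant\kappa,\kappa'\leqslant(\dim V)^+$, then the profinite-dimensional completions of $V_\kappa$ and of $V_{\kappa'}$ are isomorphic as topological vector spaces. 3. If $\aleph_0\leqslant\kappa,\kappa'\leqslant(\dim V)^+$, then the dual spaces $V_\kappa^{\circledast}$ and $V_{\kappa'}^{\circledast}$ are isomorphic as topological vector spaces.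
   Context: Fix a field $k$ with the discrete topology; all vector spaces are over $k$. $\lambda^+$ denotes the successor cardinal of $\lambda$. For a cardinal $\kappa\geqslant\aleph_0$, the $\kappa$-codimension topology $\tau_{V,\kappa}$ on a vector space $V$ is the vector space topology whose neighborhood filter of $0$ is generated by the set of all vector subspaces $W$ of $V$ with $\mathrm{codim}\, W=\dim V/W<\kappa$. An isomorphism of topological vector spaces is a linear homeomorphism. A topological vector space has linear topology if the neighborhood filter of $0$ is generated by open vector subspaces. The profinite-dimensional completion of a topological vector space $V$ is the inverse limit $\varprojlim\{V/W : W \text{ a closed vector subspace of } V,\ \mathrm{codim}\, W<\aleph_0\}$, with quotient topologies on the $V/W$, the natural projections as transition maps, and the inverse limit topology. A topological vector space with linear topology is linearly compact if it is an inverse limit of finite-dimensional discrete vector spaces, with the inverse limit topology. For a vector space $V$ with linear topology, the dual $V^{\circledast}$ is the space of continuous linear maps $V\to k$ ($k$ discrete), with the topology in which the neighborhood filter of $0$ is generated by the sets $W^\perp=\{f\in V^{\circledast} : f(W)=0\}$, for $W$ ranging over the vector subspaces of $V$ that are linearly compact in the subspace topology. *)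

(* Defs.v *)
From HB Require Import structures.
From mathcomp Require Import all_boot all_order all_algebra.
From mathcomp Require Import all_classical all_reals topology.

Set Implicit Arguments.
Unset Strict Implicit.
Unset Printing Implicit Defensive.

Import GRing.Theory.
Local Open Scope classical_set_scope.
Local Open Scope card_scope.
Local Open Scope ring_scope.
Local Open Scope quotient_scope.

(* A cardinal is given by a set (in the sense of [set T]) or by a type [K],   *)
(* through [[set: K]], and compared with the relations of [cardinality].      *)
Definition card_lt T U (A : set T) (B : set U) : Prop :=
  A #<= B /\ ~ (B #<= A).

Lemma exists_min_card (I : Type) (Y : I -> Type) : inhabited I ->
  exists i, forall j, exists f : Y i -> Y j, injective f.
Proof.
move=> [i0].
pose P (S : set (forall i, Y i)) :=
  forall i p q, S p -> S q -> p i = q i -> p = q.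
have chainP (F : set (set (forall i, Y i))) :
    F `<=` P -> total_on F subset -> P (\bigcup_(X in F) X).
  move=> FP Ftot i p q [X FX Xp] [Z FZ Zq].
  have [XZ|ZX] := Ftot _ _ FX FZ.
    by apply: (FP _ FZ) => //; exact: XZ.
  by apply: (FP _ FX) => //; exact: ZX.
have [S [PS Smax]] := Zorn_bigcup chainP.
have [i Si] : exists i, forall y, exists p, S p /\ p i = y.
  apply: contrapT => /forallNP noti.
  have /all_tag[p0 p0P] : forall i, {y | forall p, S p -> p i <> y}.
    move=> i; apply: cid; have /existsNP[y /forallNP yP] := noti i.
    by exists y => p Sp piy; apply: (yP p).
  apply: (Smax (S `|` [set p0])).
    split=> [p Sp|/(_ p0 (or_intror erefl)) Sp0]; first by left.
    exact: (p0P i0 p0 Sp0 erefl).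
  move=> i p q [Sp|->] [Sq|->] // pq; first exact: PS pq.
    by case: (p0P i p Sp).
  by case: (p0P i q Sq).
have /all_tag[g gP] : forall y, {p | S p /\ p i = y} by move=> y; exact/cid.
exists i => j; exists (fun y => g y j) => y z /= gyz.
have [Sy <-] := gP y; have [Sz <-] := gP z.
by rewrite (PS j _ _ Sy Sz gyz).
Qed.

Lemma inj_card_leT T U (A : set T) (B : set U) (f : A -> B) :
  injective f -> A #<= B.
Proof.
move=> finj; apply/card_leP/injfunPex; exists f => //.
by move=> x y _ _; exact: finj.
Qed.

Lemma card_le_total T U (A : set T) (B : set U) : A #<= B \/ B #<= A.
Proof.
pose Y (b : bool) : Type := if b then set_type A else set_type B.
have [[] minY] := @exists_min_card _ Y (inhabits true).
  by left; have [f /inj_card_leT] := minY false.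
by right; have [f /inj_card_leT] := minY true.
Qed.

Lemma card_lt_powerset T (A : set T) : card_lt A [set: set T].
Proof.
split.
  apply: card_le_trans (card_leT A) _.
  apply/card_leP/injfunPex.
  exists (fun x : [set: T] => SigSub (mem_setT [set set_val x])) => //.
  move=> x y _ _ /(congr1 val)/= xy; apply/val_inj.
  by have : [set set_val y] (set_val x) by rewrite -xy.
move=> AT; have /card_leP/injfunPex[f _ finj] :
    [set: set T] #<= [set: T] := card_le_trans AT (card_leT A).
pose g S := set_val (f (SigSub (mem_setT S))).
have ginj : injective g.
  by move=> S S' /val_inj/finj; rewrite !inE => /(_ Logic.I Logic.I)/(congr1 val).
pose D := [set x | exists2 S, g S = x & ~ S x].
have [DD|nDD] := pselect (D (g D)); last by apply: (nDD); exists D.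
by have [S /ginj-> /(_ DD)] := DD.
Qed.

Definition is_card_succ T U (A : set T) (S : set U) : Prop :=
  card_lt A S /\ forall (X : Type) (C : set X), card_lt A C -> S #<= C.

Lemma card_succ_exists T (A : set T) :
  exists S : set (set T), is_card_succ A S.
Proof.
pose I := {X : set (set T) | card_lt A X}.
have := @exists_min_card I (fun i => set_type (sval i)).
have inhI : inhabited I by apply: inhabits; exists setT; exact: card_lt_powerset.
move=> /(_ inhI)[[S ltAS] Smin]; exists S; split=> // X C ltAC.
have [//|CS] := card_le_total S C.
have /card_leP/injfunPex[f _ finj] := CS.
pose D : set (set T) := [set set_val (f x) | x in [set: C]].
have DC : D #= C.
  apply: (card_eq_trans _ (card_setT C)).
  by apply: inj_card_eq => x y xT yT /val_inj; exact: finj.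
have ltAD : card_lt A D.
  by split; [rewrite (card_le_eqr DC) | rewrite (card_le_eql DC)]; case: ltAC.
have [g /inj_card_leT] := Smin (exist _ D ltAD).
by rewrite (card_le_eqr DC).
Qed.

Definition card_succ T (A : set T) : set (set T) :=
  projT1 (cid (card_succ_exists A)).

Lemma card_succP T (A : set T) : is_card_succ A (card_succ A).
Proof. exact: projT2 (cid (card_succ_exists A)). Qed.

Section Basis.
Variables (k : fieldType) (V : lmodType k).

Definition lin_indep (B : set V) : Prop :=
  forall (s : seq V) (c : V -> k), uniq s -> [set` s] `<=` B ->
    \sum_(v <- s) c v *: v = 0 -> forall v, v \in s -> c v = 0.

Definition spanning (B : set V) : Prop :=
  forall v, exists (s : seq V) (c : V -> k),
    [set` s] `<=` B /\ v = \sum_(w <- s) c w *: w.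

Definition is_basis (B : set V) : Prop := lin_indep B /\ spanning B.

Lemma basis_exists : exists B : set V, is_basis B.
Proof.
have chain (F : set (set V)) : F `<=` lin_indep -> total_on F subset ->
    lin_indep (\bigcup_(X in F) X).
  move=> Find Ftot s c us sF.
  case: s us sF => [//|v0 s] us sF.
  have [X FX sX] : exists2 X, F X & [set` v0 :: s] `<=` X.
    have [X0 FX0 X0v] := sF v0 (mem_head _ _).
    elim: (v0 :: s) sF => [_|v t IH tF]; first by exists X0.
    have [X FX tX] : exists2 X, F X & [set` t] `<=` X.
      by apply: IH => w wt; apply: tF; rewrite /= inE; apply/orP; right.
    have [Z FZ Zv] := tF v (mem_head _ _).
    have [XZ|ZX] := Ftot _ _ FX FZ.
      by exists Z => // w; rewrite /= inE => /orP[/eqP->//|wt]; exact/XZ/tX.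
    by exists X => // w; rewrite /= inE => /orP[/eqP->|/tX//]; exact: ZX.
  exact: Find FX _ _ us sX.
have [B [indB maxB]] := Zorn_bigcup chain.
exists B; split=> // v; apply: contrapT => nspan.
apply: (maxB (B `|` [set v])).
  split=> [w Bw|/(_ v (or_intror erefl)) Bv]; first by left.
  apply: nspan; exists [:: v], (fun=> 1); split.
    by move=> w; rewrite /= inE => /eqP->.
  by rewrite big_seq1 scale1r.
move=> s c us sB s0.
have restB : [set` rem v s] `<=` B.
  move=> w /=; rewrite mem_rem_uniq// inE => /andP[wv ws].
  by have [//|/= E] := sB w ws; rewrite E eqxx in wv.
have [vs|vs] := boolP (v \in s); last first.
  apply: indB => // w ws; have [//|/= E] := sB w ws.
  by rewrite -E ws in vs.
move: s0; rewrite (perm_big _ (perm_to_rem vs)) big_cons/=.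
have [cv0|cv0 E] := eqVneq (c v) 0.
  rewrite cv0 scale0r add0r => r0 w ws.
  have [->//|wv] := eqVneq w v.
  by apply: (indB _ c (rem_uniq v us) restB r0); rewrite mem_rem_uniq// inE wv.
case: nspan; exists (rem v s), (fun w => - ((c v)^-1 * c w)); split=> //.
under eq_bigr do rewrite scaleNr -scalerA.
rewrite sumrN -scaler_sumr -[X in - (_ *: X)](addKr (c v *: v)) E addr0.
by rewrite scalerN opprK scalerA mulVf// scale1r.
Qed.

(* A chosen basis of [V]; only its cardinality matters. *)
Definition dim : set V := projT1 (cid basis_exists).

Lemma dimP : is_basis dim.
Proof. exact: projT2 (cid basis_exists). Qed.

End Basis.
Arguments dim : clear implicits.

Section SubspaceType.
Variables (k : fieldType) (V : lmodType k) (W : submodClosed V).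

(* [submodClosed] does not record closure under opposite; this alias does. *)
Definition submod_pred : {pred V} := fun x => x \in W.

Lemma submod_pred_closed : submod_closed submod_pred.
Proof.
split=> [|a x y xW yW]; first exact: (rpred0 W).
by rewrite unfold_in rpredD// rpredZ.
Qed.
HB.instance Definition _ := GRing.isSubmodClosed.Build k V submod_pred
  submod_pred_closed.

Definition subspace_of : Type := {x : V | x \in submod_pred}.
HB.instance Definition _ := [isSub of subspace_of for @sval V _].
HB.instance Definition _ := [Choice of subspace_of by <:].
HB.instance Definition _ := [SubChoice_isSubZmodule of subspace_of by <:].
HB.instance Definition _ := [SubZmodule_isSubLmodule of subspace_of by <:].

Definition quot_space : Type := Quotient.quot submod_pred.
HB.instance Definition _ := Quotient.on quot_space.
HB.instance Definition _ := GRing.Zmodule.on quot_space.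

Lemma pi_quotD : {morph (\pi_quot_space : V -> quot_space) : x y / x + y}.
Proof. exact: Quotient.pi_add. Qed.

Lemma pi_quotP (x y : V) : x = y %[mod quot_space] <-> x - y \in W.
Proof.
have -> : (x - y \in W) = (x == y %[mod Quotient.quot submod_pred]).
  by rewrite -Quotient.idealrBE.
by split=> /eqP.
Qed.

Definition quot_scale (a : k) (x : quot_space) : quot_space :=
  \pi_quot_space (a *: repr x).

Lemma pi_quotZ a (x : V) :
  \pi_quot_space (a *: x) = quot_scale a (\pi_quot_space x).
Proof.
apply/pi_quotP; rewrite -scalerBr rpredZ//.
by apply/pi_quotP; rewrite reprK.
Qed.

Let quot_scalerA a b x : quot_scale a (quot_scale b x) = quot_scale (a * b) x.
Proof. by elim/quotW: x => x; rewrite -(pi_quotZ b) -(pi_quotZ a) -pi_quotZ scalerA. Qed.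

Let quot_scale1r : left_id 1 quot_scale.
Proof. by elim/quotW => x; rewrite -pi_quotZ scale1r. Qed.

Let quot_scalerDr : right_distributive quot_scale +%R.
Proof.
move=> a; elim/quotW => x; elim/quotW => y.
by rewrite -(pi_quotZ a x) -(pi_quotZ a y) -!pi_quotD -pi_quotZ scalerDr.
Qed.

Let quot_scalerDl x : {morph quot_scale^~ x : a b / a + b}.
Proof.
by move=> a b; elim/quotW: x => x; rewrite -(pi_quotZ a) -(pi_quotZ b) -pi_quotD -pi_quotZ scalerDl.
Qed.

HB.instance Definition _ := GRing.Zmodule_isLmodule.Build k quot_space
  quot_scalerA quot_scale1r quot_scalerDr quot_scalerDl.

Lemma pi_quot_linear : linear (\pi_quot_space : V -> quot_space).
Proof. by move=> a x y; rewrite pi_quotD pi_quotZ. Qed.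

End SubspaceType.

Definition codim_lt (k : fieldType) (V : lmodType k) (W : submodClosed V)
    (K : Type) : Prop :=
  card_lt (dim k (quot_space W)) [set: K].

(* [topologicalLmodType] and [tvsType] require the scalars to form a          *)
(* [numDomainType]; here they form an arbitrary field with the discrete       *)
(* topology.                                                                  *)
HB.mixin Record isTopVect (k : fieldType) M
    & Topological M & GRing.Lmodule k M := {
  tv_add_continuous : continuous (fun z : M * M => z.1 + z.2);
  tv_scale_continuous :
    continuous (fun z : discrete_topology k * M => (z.1 : k) *: z.2)
}.

#[short(type="topVectType")]
HB.structure Definition TopVect (k : fieldType) :=
  {M of Topological M & GRing.Lmodule k M & isTopVect k M}.

HB.factory Record Lmodule_isTopVect (k : fieldType) M
    & Topological M & GRing.Lmodule k M := {
  add_cts : continuous (fun z : M * M => z.1 + z.2);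
  scale_cts : forall a : k, continuous (fun x : M => a *: x)
}.
HB.builders Context k M & Lmodule_isTopVect k M.

Let scale2_cts :
  continuous (fun z : discrete_topology k * M => (z.1 : k) *: z.2).
Proof.
move=> [a x] A /= Aax.
exists ([set a], (fun y => a *: y) @^-1` A) => /=.
  split; last exact: scale_cts Aax.
  by rewrite nbhs_principalE; exact/principal_filterP.
by move=> [b y] /= [-> ].
Qed.
HB.instance Definition _ := isTopVect.Build k M add_cts scale2_cts.
HB.end.

Lemma scale_continuous (k : fieldType) (X : topVectType k) (a : k) :
  continuous (fun x : X => a *: x).
Proof.
move=> x A Aax.
have [[B C] /= [Ba Cx] BCA] := @tv_scale_continuous k X (a, x) A Aax.
apply: filterS Cx => y Cy; apply: (BCA (a, y)); split=> //=.
exact: nbhs_singleton Ba.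
Qed.

Definition tv_iso (k : fieldType) (X Y : topVectType k) : Prop :=
  exists (f : {linear X -> Y}) (g : Y -> X),
    [/\ cancel f g, cancel g f, continuous f & continuous g].

Definition linear_topology (k : fieldType) (X : topVectType k) : Prop :=
  forall A : set X, nbhs 0 A ->
    exists W : submodClosed X, open [set x | x \in W] /\ [set x | x \in W] `<=` A.

(* [V] with the translation-invariant topology whose neighborhood filter of 0 *)
(* is generated by the subspaces in [G]; finite intersections are taken, so   *)
(* that this is a topology for every [G].                                     *)
Definition gen_topology (k : fieldType) (V : lmodType k)
  (G : set (submodClosed V)) : Type := V.

Section GenTopology.
Variables (k : fieldType) (V : lmodType k) (G : set (submodClosed V)).
Local Notation T := (gen_topology G).

HB.instance Definition _ := GRing.Lmodule.on T.

Definition gen_filter : set_system V :=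
  smallest (@Filter V) [set [set x | x \in W] | W in G].

HB.instance Definition _ := hasNbhs.Build T
  (fun x => [set A | gen_filter [set w : V | A (x + w)]]).

Lemma gen_filterP A : gen_filter A <->
  exists (I : finType) (F : I -> submodClosed V),
    (forall i, G (F i)) /\ [set w | forall i, w \in F i] `<=` A.
Proof.
split=> [|[I [F [GF FA]]] M [MF MG]].
  pose B (A : set V) := exists (I : finType) (F : I -> submodClosed V),
    (forall i, G (F i)) /\ [set w | forall i, w \in F i] `<=` A.
  move=> /(_ B); apply; split; last first.
    move=> _ [W GW <-]; exists unit, (fun=> W); split=> // w; exact.
  split.
  - by exists void, (@of_void (submodClosed V)); split=> [[]|].
  - move=> A1 A2 [I1 [F1 [G1 S1]]] [I2 [F2 [G2 S2]]].
    exists (I1 + I2)%type, (fun i => match i with inl j => F1 j | inr j => F2 j end).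
    split=> [[]//|w wF]; split; first by apply: S1 => j; exact: (wF (inl j)).
    by apply: S2 => j; exact: (wF (inr j)).
  - by move=> P Q PQ [I [F [GF SF]]]; exists I, F; split=> // w /SF/PQ.
have : M [set w | forall i, i \in enum I -> w \in F i].
  elim: (enum I) => [|i s IH].
    by apply: filterS filterT => w _ i; rewrite in_nil.
  have MFi : M [set w | w \in F i] by apply: MG; exists (F i).
  apply: filterS (filterI MFi IH) => w [wi ws] j.
  by rewrite in_cons => /orP[/eqP->|/ws].
by apply: filterS => w wF; apply: FA => i; apply: wF; rewrite mem_enum.
Qed.

Lemma gen_nbhsP (x : T) (A : set T) : nbhs x A <->
  exists (I : finType) (F : I -> submodClosed V),
    (forall i, G (F i)) /\ forall w : V, (forall i, w \in F i) -> A (x + w).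
Proof. exact: gen_filterP. Qed.

Lemma gen_nbhs0 : nbhs (0 : T) = gen_filter.
Proof.
apply/funext => A; rewrite /nbhs /=; congr gen_filter.
by apply/funext => w; congr (A _); exact: add0r.
Qed.

Let nbhs_flt (p : T) : ProperFilter (nbhs p).
Proof.
have FF : Filter gen_filter by apply: smallest_filter_filter.
have NF : Filter (nbhs p).
  split.
  - exact: (@filterT _ gen_filter).
  - by move=> A B; exact: (@filterI _ gen_filter).
  - by move=> A B AB; apply: (@filterS _ gen_filter) => w; exact: AB.
apply: Build_ProperFilter_ex => A /gen_nbhsP[I [F [_ FA]]].
by exists (p + 0); apply: FA => i; exact: rpred0.
Qed.

Let nbhs_sing (p : T) (A : set T) : nbhs p A -> A p.
Proof.
move=> /gen_nbhsP[I [F [_ FA]]]; rewrite -[p]addr0.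
by apply: FA => i; exact: rpred0.
Qed.

Let nbhs_nb (p : T) (A : set T) : nbhs p A -> nbhs p (nbhs^~ A).
Proof.
move=> /gen_nbhsP[I [F [GF FA]]]; apply/gen_nbhsP; exists I, F; split=> // w wF.
apply/gen_nbhsP; exists I, F; split=> // v vF; rewrite -addrA.
by apply: FA => i; apply: rpredD; [exact: wF|exact: vF].
Qed.

HB.instance Definition _ := Nbhs_isNbhsTopological.Build T
  nbhs_flt nbhs_sing nbhs_nb.

Let gen_add : continuous (fun z : T * T => z.1 + z.2).
Proof.
move=> [x y] A /= /gen_nbhsP[I [F [GF FA]]].
pose U (p : T) : set T := [set q | forall i, (q - p : V) \in F i].
have nU p : nbhs p (U p).
  by apply/gen_nbhsP; exists I, F; split=> // w wF i; rewrite addrC addKr.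
exists (U x, U y) => /=; first by split; exact: nU.
move=> [x' y'] [/= Ux Uy].
have -> : x' + y' = x + y + ((x' - x) + (y' - y)).
  by rewrite addrACA [x + _]addrC [y + _]addrC !subrK.
by apply: FA => i; apply: rpredD; [exact: Ux|exact: Uy].
Qed.

Let gen_scale (a : k) : continuous (fun x : T => a *: x).
Proof.
move=> x A /= /gen_nbhsP[I [F [GF FA]]]; apply/gen_nbhsP.
exists I, F; split=> // w wF /=; rewrite scalerDr.
by apply: FA => i; apply: rpredZ; exact: wF.
Qed.

HB.instance Definition _ := Lmodule_isTopVect.Build k T gen_add gen_scale.

Lemma gen_linear_topology : linear_topology T.
Proof.
move=> A /gen_nbhsP[I [F [GF FA]]].
pose W : {pred T} := fun w => [forall i, (w : V) \in F i].
have Wclosed : submod_closed W.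
  split=> [|a x y /forallP xF /forallP yF]; apply/forallP => i.
    exact: (rpred0 (F i)).
  by apply: rpredD (yF i); apply: rpredZ; exact: (xF i).
pose hW := GRing.isSubmodClosed.Build k T W Wclosed.
pose WS : submodClosed T := HB.pack W hW.
exists WS; split=> [|w /forallP wF]; last by rewrite -[w]add0r; exact: FA.
rewrite openE => x /forallP xF; apply/gen_nbhsP; exists I, F; split=> // w wF.
by apply/forallP => i; exact: rpredD (xF i) (wF i).
Qed.

End GenTopology.

Definition codim_space (k : fieldType) (V : lmodType k) (K : Type) :
    topVectType k :=
  gen_topology [set W : submodClosed V | codim_lt W K].

Section SubspaceTopology.
Variables (k : fieldType) (X : topVectType k) (W : submodClosed X).
Local Notation S := (subspace_of W).

HB.instance Definition _ := Topological.copy S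
  (initial_topology (val : S -> X)).

Let val_cts : continuous (val : S -> X).
Proof. exact: initial_continuous. Qed.

Let sub_add : continuous (fun z : S * S => z.1 + z.2).
Proof.
apply: (@continuous_comp_initial S (S * S)%type X val) => z.
apply: (@continuous2_cvg _ X X X _ _ (fun z : S * S => val z.1)
  (fun z => val z.2) (fun x y => x + y)).
- exact: (@tv_add_continuous k X (val z.1, val z.2)).
- by apply: cvg_comp; [exact: cvg_fst|exact: val_cts].
- by apply: cvg_comp; [exact: cvg_snd|exact: val_cts].
Qed.

Let sub_scale (a : k) : continuous (fun x : S => a *: x).
Proof.
apply: (@continuous_comp_initial S S X val) => z.
apply: (@continuous_comp S X X val (fun x => a *: x)); first exact: val_cts.
exact: scale_continuous.
Qed.

HB.instance Definition _ := Lmodule_isTopVect.Build k S sub_add sub_scale.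

End SubspaceTopology.

Section QuotientTopology.
Variables (k : fieldType) (X : topVectType k) (W : submodClosed X).
Local Notation Q := (quot_space W).

Let Qopen : set_system Q := [set U | open (\pi_Q @^-1` U : set X)].
Let QopenT : Qopen setT.
Proof. by rewrite /Qopen /= preimage_setT; exact: openT. Qed.
Let QopenI : setI_closed Qopen.
Proof. by move=> A B; exact: openI. Qed.
Let Qopen_bigU (I : Type) (f : I -> set Q) :
  (forall i, Qopen (f i)) -> Qopen (\bigcup_i f i).
Proof. by move=> fo; apply: bigcup_open => i _; exact: fo. Qed.
HB.instance Definition _ := isOpenTopological.Build Q QopenT QopenI Qopen_bigU.

Lemma pi_quot_continuous : continuous (\pi_Q : X -> Q).
Proof. exact/continuousP. Qed.

Let translate_continuous (w : X) : continuous (fun x : X => x + w).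
Proof.
move=> x; apply: (@continuous2_cvg _ X X X _ _ id (cst w) (fun x y => x + y)).
- exact: (@tv_add_continuous k X (x, w)).
- exact: cvg_id.
- exact: cvg_cst.
Qed.

Lemma pi_quot_open (U : set X) : open U -> open (\pi_Q @` U : set Q).
Proof.
move=> oU; rewrite /open /= /Qopen /=.
have -> : \pi_Q @^-1` (\pi_Q @` U) = \bigcup_(w in [set w | w \in W])
    ((fun x : X => x + w) @^-1` U).
  apply/seteqP; split=> [x [u Uu /pi_quotP ux]|x [w /= wW Ux]].
    by exists (u - x) => //=; rewrite addrC subrK.
  by exists (x + w) => //; apply/pi_quotP; rewrite addrC addKr.
apply: bigcup_open => w _; have /continuousP := @translate_continuous w.
by apply.
Qed.

Let pi_nbhs (x : X) (B : set X) : nbhs x B -> nbhs (\pi_Q x : Q) (\pi_Q @` B).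
Proof.
rewrite nbhsE => -[U [oU Ux] UB]; rewrite nbhsE; exists (\pi_Q @` U).
  by split; [exact: pi_quot_open|exists x].
exact: image_subset.
Qed.

Let quot_add : continuous (fun z : Q * Q => z.1 + z.2).
Proof.
move=> [p q]; elim/quotW: p => x; elim/quotW: q => y A /=.
rewrite -pi_quotD => /pi_quot_continuous/(@tv_add_continuous k X (x, y)).
move=> [[B C] /= [Bx Cy] BCA].
exists (\pi_Q @` B, \pi_Q @` C) => /=; first by split; exact: pi_nbhs.
move=> [_ _] /= [[b Bb <-] [c Cc <-]]; rewrite -pi_quotD.
exact: (BCA (b, c)).
Qed.

Let quot_sc (a : k) : continuous (fun x : Q => a *: x).
Proof.
move=> p; elim/quotW: p => x A.
rewrite /= -[a *: _]/(quot_scale a _) -pi_quotZ.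
move=> /pi_quot_continuous/(@scale_continuous k X a x) nA.
apply: filterS (pi_nbhs nA) => _ [y /= Ay <-].
by rewrite -[a *: _]/(quot_scale a _) -pi_quotZ.
Qed.
HB.instance Definition _ := Lmodule_isTopVect.Build k Q quot_add quot_sc.

End QuotientTopology.

Definition tv_prod (k : fieldType) (I : Type) (X : I -> topVectType k) : Type :=
  prod_topology X.

Section Product.
Variables (k : fieldType) (I : Type) (X : I -> topVectType k).
Local Notation P := (tv_prod X).

HB.instance Definition _ := Topological.on P.

Let pzero : P := fun i => 0.
Let padd (f g : P) : P := fun i => f i + g i.
Let popp (f : P) : P := fun i => - f i.
Let pscale (a : k) (f : P) : P := fun i => a *: f i.
Let paddA : associative padd.
Proof. by move=> f g h; apply: functional_extensionality_dep => i; exact: addrA. Qed.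
Let paddC : commutative padd.
Proof. by move=> f g; apply: functional_extensionality_dep => i; exact: addrC. Qed.
Let padd0 : left_id pzero padd.
Proof. by move=> f; apply: functional_extensionality_dep => i; exact: add0r. Qed.
Let paddN : left_inverse pzero popp padd.
Proof. by move=> f; apply: functional_extensionality_dep => i; exact: addNr. Qed.
HB.instance Definition _ := GRing.isZmodule.Build P paddA paddC padd0 paddN.
Let pscaleA a b f : pscale a (pscale b f) = pscale (a * b) f.
Proof. by apply: functional_extensionality_dep => i; exact: scalerA. Qed.
Let pscale1 : left_id 1 pscale.
Proof. by move=> f; apply: functional_extensionality_dep => i; exact: scale1r. Qed.
Let pscaleDr : right_distributive pscale +%R.
Proof. by move=> a f g; apply: functional_extensionality_dep => i; exact: scalerDr. Qed.
Let pscaleDl f : {morph pscale^~ f : a b / a + b}.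
Proof. by move=> a b; apply: functional_extensionality_dep => i; exact: scalerDl. Qed.
HB.instance Definition _ := GRing.Zmodule_isLmodule.Build k P
  pscaleA pscale1 pscaleDr pscaleDl.

Lemma tv_proj_continuous i : continuous (fun f : P => f i).
Proof.
move=> f; have /cvg_sup/(_ i) ff : nbhs f --> f by exact: cvg_id.
by move=> A /(@initial_continuous _ _ (fun g : forall j, X j => g i) f)/ff.
Qed.

Lemma tv_prod_continuous (Z : topologicalType) (f : Z -> P) :
  (forall i, continuous (fun z => f z i)) -> continuous f.
Proof.
move=> fc z; apply/cvg_sup => i U [_ [[W oW <-] Wfz]] /filterS; apply.
exact: (fc i z W (open_nbhs_nbhs (conj oW Wfz))).
Qed.

Let prod_add : continuous (fun z : P * P => z.1 + z.2).
Proof.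
apply: tv_prod_continuous => i z.
apply: (@continuous2_cvg _ (X i) (X i) (X i) _ _ (fun z : P * P => z.1 i)
  (fun z => z.2 i) (fun x y => x + y)).
- exact: (@tv_add_continuous k (X i) (z.1 i, z.2 i)).
- apply: (@continuous_comp (P * P)%type P (X i) fst (fun f : P => f i)).
    exact: cvg_fst.
  exact: tv_proj_continuous.
- apply: (@continuous_comp (P * P)%type P (X i) snd (fun f : P => f i)).
    exact: cvg_snd.
  exact: tv_proj_continuous.
Qed.

Let prod_sc (a : k) : continuous (fun x : P => a *: x).
Proof.
apply: tv_prod_continuous => i z.
apply: (@continuous_comp P (X i) (X i) (fun f : P => f i) (fun x => a *: x)).
  exact: tv_proj_continuous.
exact: scale_continuous.
Qed.
HB.instance Definition _ := Lmodule_isTopVect.Build k P prod_add prod_sc.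

End Product.

(* The transition map attached to [i <= j] goes from the [j]-th to the [i]-th *)
(* space. Directedness is the separate predicate [is_directed].               *)
Record inverse_system (k : fieldType) := InverseSystem {
  sys_index : Type;
  sys_le : sys_index -> sys_index -> Prop;
  sys_le_refl : forall i, sys_le i i;
  sys_le_trans : forall i j l, sys_le i j -> sys_le j l -> sys_le i l;
  sys_obj : sys_index -> topVectType k;
  sys_map : forall i j, sys_le i j -> sys_obj j -> sys_obj i;
  sys_map_linear : forall i j (h : sys_le i j), linear (sys_map h);
  sys_map_continuous : forall i j (h : sys_le i j), continuous (sys_map h);
  sys_map_id : forall i (h : sys_le i i) x, sys_map h x = x;
  sys_map_comp : forall i j l (hij : sys_le i j) (hjl : sys_le j l)
    (hil : sys_le i l) x, sys_map hij (sys_map hjl x) = sys_map hil x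
}.

Definition is_directed (k : fieldType) (S : inverse_system k) : Prop :=
  inhabited (sys_index S) /\
  forall i j : sys_index S, exists l, sys_le i l /\ sys_le j l.

Section InverseLimit.
Variables (k : fieldType) (S : inverse_system k).

Definition compatible : {pred tv_prod (@sys_obj k S)} :=
  fun f => `[< forall i j (h : sys_le i j), sys_map h (f j) = f i >].

Lemma compatible_closed : submod_closed compatible.
Proof.
split=> [|a f g /asboolP fc /asboolP gc]; apply/asboolP => i j h.
  by have := sys_map_linear h (-1) 0 0; rewrite scaler0 addr0 scaleN1r addNr.
by rewrite sys_map_linear fc gc.
Qed.
HB.instance Definition _ := GRing.isSubmodClosed.Build k
  (tv_prod (@sys_obj k S)) compatible compatible_closed.

Definition inverse_limit : topVectType k := subspace_of compatible.

End InverseLimit.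

Definition linearly_compact (k : fieldType) (X : topVectType k) : Prop :=
  linear_topology X /\
  exists S : inverse_system k,
    [/\ is_directed S,
        forall i : sys_index S, finite_set (dim k (sys_obj i)),
        forall (i : sys_index S) (A : set (sys_obj i)), open A &
        tv_iso X (inverse_limit S)].

Section Completion.
Variables (k : fieldType) (X : topVectType k).

Definition closed_cofinite : Type :=
  {W : submodClosed X | closed [set x | x \in W] /\ codim_lt W nat}.

(* Ordered by reverse inclusion. *)
Definition cc_le (U W : closed_cofinite) : Prop := {subset sval W <= sval U}.

(* The natural projection [X/W -> X/U], [x + W |-> x + U]. *)
Definition quot_proj (U W : closed_cofinite) (_ : cc_le U W)
  (x : quot_space (sval W)) : quot_space (sval U) :=
  \pi_(quot_space (sval U)) (repr x).

Lemma quot_projE U W (h : cc_le U W) x :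
  quot_proj h (\pi_(quot_space (sval W)) x) = \pi_(quot_space (sval U)) x.
Proof. by apply/pi_quotP/h/pi_quotP; rewrite reprK. Qed.

Lemma cc_le_refl U : cc_le U U. Proof. by []. Qed.

Lemma cc_le_trans U W Z : cc_le U W -> cc_le W Z -> cc_le U Z.
Proof. by move=> UW WZ x /WZ/UW. Qed.

Lemma quot_proj_linear U W (h : cc_le U W) : linear (quot_proj h).
Proof.
move=> a; elim/quotW => x; elim/quotW => y.
by rewrite -pi_quot_linear !quot_projE pi_quot_linear.
Qed.

Lemma quot_proj_continuous U W (h : cc_le U W) : continuous (quot_proj h).
Proof.
apply/continuousP => A oA; rewrite /open /=.
rewrite [X in open X](_ : _ = \pi_(quot_space (sval U)) @^-1` A) //.
by apply/seteqP; split=> x /=; rewrite quot_projE.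
Qed.

Lemma quot_proj_id U (h : cc_le U U) x : quot_proj h x = x.
Proof. by elim/quotW: x => x; rewrite quot_projE. Qed.

Lemma quot_proj_comp U W Z (hUW : cc_le U W) (hWZ : cc_le W Z)
  (hUZ : cc_le U Z) x : quot_proj hUW (quot_proj hWZ x) = quot_proj hUZ x.
Proof. by elim/quotW: x => x; rewrite (quot_projE hWZ) (quot_projE hUW) (quot_projE hUZ). Qed.

Definition completion_system : inverse_system k :=
  @InverseSystem k closed_cofinite cc_le cc_le_refl cc_le_trans
    (fun W => quot_space (sval W)) quot_proj quot_proj_linear
    quot_proj_continuous quot_proj_id quot_proj_comp.

Definition profinite_completion : topVectType k :=
  inverse_limit completion_system.

End Completion.

Section Dual.
Variables (k : fieldType) (X : topVectType k).

Definition continuous_dual_pred : {pred X -> k^o} :=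
  fun f => `[< linear f /\ continuous (f : X -> discrete_topology k) >].

Lemma continuous_dual_closed : submod_closed continuous_dual_pred.
Proof.
split=> [|a f g /asboolP[fl fc] /asboolP[gl gc]]; apply/asboolP; split.
- by move=> a x y; rewrite -[LHS]/0 -[RHS]/(a *: 0 + 0) scaler0 addr0.
- move=> x A /= A0; apply: (@filterS _ (nbhs x) _ setT); last exact: filterT.
  move=> y _.
  exact: (@nbhs_singleton (discrete_topology k) 0 A A0).
- move=> b x y; rewrite -[LHS]/(a *: f _ + g _) -[RHS]/(b *: (a *: f x + g x) + (a *: f y + g y)).
  by rewrite fl gl !scalerDr !scalerA [b * a]mulrC addrACA.
- move=> x A /= Ax.
  have fx : nbhs x (fun y => f y = f x).
    apply: (fc x [set f x]); rewrite nbhs_principalE; exact/principal_filterP.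
  have gx : nbhs x (fun y => g y = g x).
    apply: (gc x [set g x]); rewrite nbhs_principalE; exact/principal_filterP.
  apply: (@filterS _ (nbhs x) _ _ _ _ (filterI fx gx)) => y [fy gy] /=.
  have -> : (a *: f + g) y = (a *: f + g) x.
    by rewrite -[LHS]/(a *: f y + g y) fy gy.
  exact: (@nbhs_singleton (discrete_topology k) _ A Ax).
Qed.
HB.instance Definition _ := GRing.isSubmodClosed.Build k (X -> k^o)
  continuous_dual_pred continuous_dual_closed.

Definition continuous_dual : lmodType k := subspace_of continuous_dual_pred.

Definition perp (L : submodClosed X) : {pred continuous_dual} :=
  fun f => `[< forall x, x \in L -> val f x = 0 >].

Lemma perp_closed L : submod_closed (perp L).
Proof.
split=> [|a f g /asboolP fL /asboolP gL]; apply/asboolP => x xL //=.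
by rewrite -[LHS]/(a *: val f x + val g x) fL// gL// scaler0 addr0.
Qed.
HB.instance Definition _ L := GRing.isSubmodClosed.Build k continuous_dual
  (perp L) (@perp_closed L).

Definition dual : topVectType k := gen_topology
  [set (perp L : submodClosed continuous_dual) | L in
     [set L : submodClosed X | linearly_compact (subspace_of L)]].

End Dual.

Definition card_admissible (k : fieldType) (V : lmodType k) (K : Type) : Prop :=
  [set: nat] #<= [set: K] /\ [set: K] #<= card_succ (dim k V).

(* Main.v *)
(* Let [K < K'], so that [K <= dim V]. If [f] is a linear homeomorphism from
   [V_K] to [V_K'], pick a subspace [W] of codimension exactly [K]: it is open in
   [V_K'], so [f^-1 W] contains a finite intersection of subspaces [F i] of
   codimension less than [K]. Then [K] many vectors are independent in the product
   of the [V / F i], whose dimension is a finite sum of cardinals less than the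
   infinite cardinal [K]: a contradiction.
   In every [V_K] all subspaces of finite codimension are open, hence closed, with
   discrete quotient, so the completions do not depend on [K]. All functionals are
   then continuous, and the linearly compact subspaces are exactly the
   finite-dimensional ones, so the duals do not depend on [K] either. *)
From HB Require Import structures.
From mathcomp Require Import all_boot all_algebra.
From mathcomp Require Import all_classical topology.
Require Import Defs.

Set Implicit Arguments.
Unset Strict Implicit.
Unset Printing Implicit Defensive.

Import GRing.Theory.
Local Open Scope classical_set_scope.
Local Open Scope card_scope.
Local Open Scope ring_scope.
Local Open Scope quotient_scope.

(** * Linear functionals and independence *)

Section Functionals.
Variable k : fieldType.

Lemma ex_linear (U V : lmodType k) (f : U -> V) :
  linear f -> exists F : {linear U -> V}, F =1 f.
Proof.
move=> fl; pose h := GRing.isLinear.Build k U V *:%R f fl.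
pose F : {linear U -> V} := HB.pack f h.
by exists F.
Qed.

(** Such a set of pairs is the graph of a functional defined on a subspace of [D]. Partial
    functionals encoded this way are ordered by inclusion, ready for [Zorn_bigcup]. *)
Definition functional_graph (D : lmodType k) (G : set (D * k)) : Prop :=
  [/\ G (0, 0),
      forall a x y b c, G (x, b) -> G (y, c) -> G (a *: x + y, a * b + c)
    & forall a, G (0, a) -> a = 0].

Lemma functional_graph_extend (D : lmodType k) (G : set (D * k)) :
  functional_graph G ->
  exists xi : {linear D -> k^o}, forall p, G p -> xi p.1 = p.2.
Proof.
move=> fG.
(* The guard on nonemptiness admits the union of the empty chain, which is not a graph. *)
pose P (X : set (D * k)) := X !=set0 -> functional_graph X /\ G `<=` X.
have chain (F : set (set (D * k))) : F `<=` P -> total_on F subset ->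
    P (\bigcup_(X in F) X).
  move=> FP Ftot [p [X0 FX0 X0p]].
  have good X q : F X -> X q -> functional_graph X /\ G `<=` X.
    by move=> FX Xq; apply: FP FX _; exists q.
  have [[X00 _ _] GX0] := good _ _ FX0 X0p.
  split; last by move=> q /GX0; exists X0.
  split; first by exists X0.
    move=> a x y b c [X FX Xx] [Y FY Yy].
    have [XY|YX] := Ftot _ _ FX FY.
      by exists Y => //; have [[_ Yl _] _] := good _ _ FY Yy; apply: Yl => //; apply: XY.
    by exists X => //; have [[_ Xl _] _] := good _ _ FX Xx; apply: Xl => //; apply: YX.
  by move=> a [X FX Xa]; have [[_ _ Xf] _] := good _ _ FX Xa; exact: Xf.
have [M [PM maxM]] := Zorn_bigcup chain.
have [M0|M0] := pselect (M !=set0); last first.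
  have M00 : M = set0 by apply/seteqP; split=> // p Mp; apply: M0; exists p.
  case: (maxM G); last by move=> _; split.
  rewrite M00; split=> // /(_ (0, 0)); apply; by case: fG.
have [[Mz Ml Mf] GM] := PM M0.
have Mfun x b c : M (x, b) -> M (x, c) -> b = c.
  move=> xb xc; have := Ml (-1) _ _ _ _ xb xc.
  rewrite scaleN1r addNr mulN1r => /Mf /eqP.
  by rewrite addrC subr_eq0 => /eqP.
have Mtot x : exists b, M (x, b).
  apply: contrapT => /forallNP nx.
  (* Adjoin [x] to the domain with value 0. *)
  pose N : set (D * k) := [set p | exists a y b, M (y, b) /\ p = (a *: x + y, b)].
  apply: (maxM N).
    split; first by move=> [y b] Myb; exists 0, y, b; rewrite scale0r add0r.
    move=> /(_ (x, 0)) NM; apply: (nx 0); apply: NM.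
    by exists 1, 0, 0; rewrite scale1r addr0.
  move=> _; split; last first.
    by move=> [y b] /GM Myb; exists 0, y, b; rewrite scale0r add0r.
  split.
  - by exists 0, 0, 0; rewrite scale0r add0r.
  - move=> a _ _ _ _ [a1 [y1 [b1 [M1 [-> ->]]]]] [a2 [y2 [b2 [M2 [-> ->]]]]].
    exists (a * a1 + a2), (a *: y1 + y2), (a * b1 + b2); split; first exact: Ml.
    by rewrite scalerDr scalerA scalerDl addrACA.
  - move=> c [a [y [b [Myb [E ->]]]]].
    have [a0|a0] := eqVneq a 0.
      by apply: Mf; move: E; rewrite a0 scale0r add0r => ->.
    (* As [a] is invertible, [x] is a multiple of [y], so [M] already gives it a value. *)
    case: (nx (- (a^-1 * b))).
    have := Ml (- a^-1) _ _ _ _ Myb Mz; rewrite !addr0 mulNr.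
    have -> : y = - (a *: x) by apply/eqP; rewrite -addr_eq0 addrC -E.
    by rewrite scaleNr scalerN opprK scalerA mulVf// scale1r.
have [f fM] := choice Mtot.
have fl : linear (f : D -> k^o).
  by move=> a x y; apply: Mfun (fM _) _; exact: Ml.
have [xi xiE] := ex_linear fl.
exists xi => -[x b] /GM Mxb; rewrite xiE; exact: Mfun Mxb.
Qed.

(** Families rather than sets: a repeated vector is a dependency, so cardinality bounds concern the
    index set [D]. *)
Definition indep (I : eqType) (V : lmodType k) (D : set I) (g : I -> V) : Prop :=
  forall (s : seq I) (c : I -> k), uniq s -> [set` s] `<=` D ->
    \sum_(i <- s) c i *: g i = 0 -> forall i, i \in s -> c i = 0.

(* Equivalent to spanning, but stable under linear images without any
   bookkeeping of coefficients. *)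
Definition total (V : lmodType k) (T : set V) : Prop :=
  forall xi : {linear V -> k^o}, (forall t, T t -> xi t = 0) ->
    forall v, xi v = 0.

(** The pairs [(g i, h i)] span a functional graph: independence leaves only the trivial combination
    above 0. *)
Lemma indep_extend (I : eqType) (V : lmodType k) (D : set I) (g : I -> V)
    (h : I -> k) : indep D g ->
  exists xi : {linear V -> k^o}, forall i, D i -> xi (g i) = h i.
Proof.
move=> indD.
pose G : set (V * k) := [set p | exists s c, [/\ uniq s, [set` s] `<=` D &
  p = (\sum_(i <- s) c i *: g i, \sum_(i <- s) c i * h i)]].
have [|xi xiP] := @functional_graph_extend V G; last first.
  exists xi => i Di; apply: (xiP (g i, h i)); exists [:: i], (fun=> 1).
  by split=> //; [move=> j /=; rewrite inE => /eqP->
                 | rewrite !big_seq1 scale1r mul1r].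
split.
- by exists [::], (fun=> 0); rewrite !big_nil.
- move=> a _ _ _ _ [s [c [us sD [-> ->]]]] [t [d [ut tD [-> ->]]]].
  (* Two combinations are added over a common support, with coefficients extended by 0. *)
  pose u := undup (s ++ t).
  pose c' i := if i \in s then c i else 0.
  pose d' i := if i \in t then d i else 0.
  have ext (U : lmodType k) (x : I -> U) (r : seq I) (e : I -> k) :
      uniq r -> {subset r <= u} -> \sum_(i <- r) e i *: x i =
      \sum_(i <- u) (if i \in r then e i else 0) *: x i.
    move=> ur ru; rewrite [RHS](bigID (mem r))/= [X in _ + X]big1 ?addr0.
      rewrite -[RHS]big_filter (perm_big [seq i <- u | i \in r]).
        by rewrite !big_filter; apply: eq_bigr => i ->.
      apply: uniq_perm => //; first by rewrite filter_uniq// undup_uniq.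
      by move=> i; rewrite mem_filter /=; case: (boolP (i \in r)) => //= /ru.
    by move=> i /negPf->; rewrite scale0r.
  have su : {subset s <= u} by move=> i is_; rewrite mem_undup mem_cat is_.
  have tu : {subset t <= u} by move=> i is_; rewrite mem_undup mem_cat is_ orbT.
  exists u, (fun i => a * c' i + d' i); split; first exact: undup_uniq.
    by move=> i /=; rewrite mem_undup mem_cat => /orP[/sD|/tD].
  rewrite (ext _ g s c)// (ext _ g t d)//.
  have extM r (e : I -> k) : uniq r -> {subset r <= u} ->
      \sum_(i <- r) e i * h i =
      \sum_(i <- u) (if i \in r then e i else 0) * h i := @ext k^o h r e.
  rewrite (extM s c)// (extM t d)//.
  rewrite scaler_sumr mulr_sumr -!big_split; congr pair; apply: eq_bigr => i _ /=.
    by rewrite scalerA -scalerDl.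
  by rewrite mulrA -mulrDl.
- move=> a [s [c [us sD [/esym s0 ->]]]].
  rewrite big_seq big1// => i si; by rewrite (indD s c us sD s0)// mul0r.
Qed.

Lemma spanning_total (V : lmodType k) (T : set V) : spanning T -> total T.
Proof.
move=> spT xi xi0 v; have [s [c [sT ->]]] := spT v.
rewrite linear_sum big_seq big1// => w ws.
by rewrite linearZ/= xi0 ?mulr0//; [exact: scaler0|exact: sT].
Qed.

Lemma dim_indep (V : lmodType k) : indep (dim k V) id.
Proof. by case: (dimP V). Qed.

Lemma dim_total (V : lmodType k) : total (dim k V).
Proof. by apply: spanning_total; case: (dimP V). Qed.

Lemma ex_separating (V : lmodType k) (v : V) : v != 0 ->
  exists xi : {linear V -> k^o}, xi v = 1.
Proof.
move=> v0; have [|xi xi1] := @indep_extend V V [set v] id (fun=> 1); last first.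
  by exists xi; exact: xi1.
move=> s c us sv; case: s us sv => // w s us sv s0 i si.
have ts j : j \in w :: s -> j = v by move=> /sv.
have s_nil : s = [::].
  case: s us ts {sv s0 si} => // u s us ts.
  have uv : u = v by apply: ts; rewrite !inE eqxx orbT.
  have wv : w = v by apply: ts; exact: mem_head.
  by move: us; rewrite uv wv /= inE eqxx.
move: s0; rewrite s_nil big_seq1 (ts w) ?mem_head// (ts i si) => /eqP.
by rewrite scaler_eq0 (negPf v0) orbF => /eqP.
Qed.

End Functionals.

(** * Cardinalities of independent families *)

Lemma set_inj_card_le (T U : Type) (A : set T) (B : set U) (f : T -> U) :
  set_fun A B f -> {in A &, injective f} -> A #<= B.
Proof.
move=> fAB finj; have [F] : $|{injfun A >-> B}| by apply/injfunPex; exists f.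
exact: inj_card_le F.
Qed.

Lemma card_le_set_inj (T U : Type) (u : U) (A : set T) (B : set U) :
  A #<= B -> exists2 f : T -> U, set_fun A B f & {in A &, injective f}.
Proof.
elim/Ppointed: U => U in u B *; first by case: (no u).
by move=> /pcard_leP/injfunPex.
Qed.

Lemma card_le_setU_double (T : Type) (A B : set T) :
  A #<= B -> A `|` B #<= B `*` [set: bool].
Proof.
elim/Ppointed: T => T in A B *; first by rewrite !emptyE.
move=> /(card_le_set_inj point)[h hAB hinj].
pose f x := if x \in B then (x, false) else (h x, true).
apply: (@set_inj_card_le _ _ _ _ f) => [x|x y].
  rewrite /f; case: ifPn => [/set_mem Bx _//|/negP nB [/hAB//|Bx]].
  by case: nB; exact: mem_set.
rewrite /f !inE => Ax Ay; case: ifPn => xB; case: ifPn => yB //= -[] //.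
have [xA yA] : x \in A /\ y \in A.
  rewrite !inE; case: Ax => [?|/mem_set]; last by rewrite (negPf xB).
  by case: Ay => [?|/mem_set]; last by rewrite (negPf yB).
exact: hinj.
Qed.

(* Tile [B] by disjoint injective sequences, up to a finite remainder, and
   double each sequence by [(p n, b) |-> p (2 n + b)]. *)
Lemma infinite_card_double (T : Type) (B : set T) :
  infinite_set B -> B `*` [set: bool] #<= B.
Proof.
elim/Ppointed: T => T in B *; first by rewrite !emptyE.
move=> infB.
pose P (F : set (nat -> T)) :=
  (forall p, F p -> injective p /\ forall n, B (p n)) /\
  (forall p q i j, F p -> F q -> p i = q j -> p = q).
have [C CP Ctot|F [[FB Fdisj] maxF]] := @Zorn_bigcup _ P.
  split=> [p [F CF Fp]|p q i j [F CF Fp] [G CG Gq]].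
    by have [FB _] := CP _ CF; exact: FB.
  have [FG|GF] := Ctot _ _ CF CG.
    by have [_ Gd] := CP _ CG; apply: Gd => //; exact: FG.
  by have [_ Fd] := CP _ CF; apply: Fd => //; exact: GF.
pose D : set T := [set x | exists p n, F p /\ p n = x].
have DB : D `<=` B by move=> _ [p [n [/FB[_ pB] <-]]].
(* An infinite remainder would contain an injective sequence, which could be added to [F]. *)
have finBD : finite_set (B `\` D).
  apply: contrapT => /infiniteP/(card_le_set_inj point)[q qBD qinj].
  have {}qinj : injective q by move=> i j; apply: qinj; rewrite inE.
  have {}qBD n : B (q n) /\ ~ D (q n) by exact: qBD.
  apply: (maxF (F `|` [set q])).
    split=> [p Fp|/(_ q (or_intror erefl)) Fq]; first by left.
    by case: (qBD 0) => _; apply; exists q, 0.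
  split=> [p [/FB//|->]|p p' i j]; first by split=> // n; case: (qBD n).
  move=> [Fp|->] [Fp'|->] //; first exact: Fdisj.
    by move=> pq; case: (qBD j) => _ []; exists p, i.
  by move=> pq; case: (qBD i) => _ []; exists p', j.
have infD : infinite_set D.
  move=> finD; apply: infB; apply: (sub_finite_set _ (_ : finite_set (D `|` (B `\` D)))).
    by move=> x Bx; have [Dx|nDx] := pselect (D x); [left|right].
  by rewrite finite_setU.
have doubleD : D `*` [set: bool] #<= D.
  have /choice[c cP] x : exists pn : (nat -> T) * nat,
      D x -> F pn.1 /\ pn.1 pn.2 = x.
    have [[p [n [Fp pn]]]|nD] := pselect (D x); first by exists (p, n).
    by exists (fun=> x, 0).
  pose f (z : T * bool) := (c z.1).1 ((c z.1).2.*2 + z.2)%N.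
  apply: (@set_inj_card_le _ _ _ _ f) => [[x b] [/= Dx _]|[x b] [y d]].
    by have [Fp _] := cP x Dx; exists (c x).1, ((c x).2.*2 + b)%N.
  rewrite !inE => -[/= Dx _] [/= Dy _]; rewrite /f /=.
  have [Fx xE] := cP x Dx; have [Fy yE] := cP y Dy => fxy.
  have pE := Fdisj _ _ _ _ Fx Fy fxy.
  move: fxy; rewrite pE => /(FB _ Fy).1 nE.
  have bE : b = d by have := congr1 odd nE; rewrite !oddD !odd_double /= !oddb.
  have : (c x).2.*2 = (c y).2.*2 by apply/eqP; rewrite -(eqn_add2r b) {2}bE nE.
  by move=> /double_inj mE; rewrite -xE -yE pE mE bE.
(* The finite remainder injects into [D], so [B] embeds in two copies of [D], hence in [D]. *)
have BD : B #<= D.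
  apply: card_le_trans doubleD.
  have BDD : B `<=` (B `\` D) `|` D.
    by move=> x Bx; have [Dx|nDx] := pselect (D x); [right|left].
  apply: card_le_trans (subset_card_le BDD) _; apply: card_le_setU_double.
  apply: card_le_trans (iffLR (infiniteP _) infD).
  exact: finite_set_countable.
apply: card_le_trans (subset_card_le DB); apply: card_le_trans doubleD.
have /(card_le_set_inj point)[h hBD hinj] := BD.
apply: (@set_inj_card_le _ _ _ _ (fun z => (h z.1, z.2))) => [[x b] [/= /hBD]//|].
move=> [x b] [y d]; rewrite !inE => -[/= Bx _] [/= By _] [hE ->].
by rewrite (hinj x y)// inE.
Qed.

(** The union embeds in two copies of the larger set, which absorbs the doubling when infinite. *)
Lemma infinite_card_le_setU (T U : Type) (S : set T) (A B : set U) :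
  infinite_set S -> S #<= A `|` B -> S #<= A \/ S #<= B.
Proof.
move=> infS; wlog AB : A B / A #<= B => [wl|] SAB.
  have [AB|BA] := card_le_total A B; first exact: wl.
  by rewrite setUC in SAB; case: (wl _ _ BA SAB); [right|left].
right; have [finB|infB] := pselect (finite_set B).
  case: infS; apply: card_le_finite SAB _; rewrite finite_setU; split=> //.
  exact: card_le_finite AB finB.
apply: card_le_trans SAB _; apply: card_le_trans (infinite_card_double infB).
exact: card_le_setU_double.
Qed.

Lemma infinite_card_le_bigcup (T U : Type) (I : finType) (S : set T)
    (A : I -> set U) :
  infinite_set S -> S #<= \bigcup_i A i -> exists i, S #<= A i.
Proof.
move=> infS SA; have {SA} : S #<= \bigcup_(i in [set` enum I]) A i.
  apply: card_le_trans SA _; apply: subset_card_le => x [i _ Aix].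
  by exists i => //=; rewrite mem_enum.
elim: (enum I) => [|i s IH].
  move=> S0; case: infS; apply: card_le_finite S0 _.
  by rewrite (_ : \bigcup_(i in _) A i = set0) // -subset0 => x [].
move=> Sis; have {Sis} : S #<= A i `|` \bigcup_(j in [set` s]) A j.
  apply: card_le_trans Sis (subset_card_le _) => x [j /=].
  by rewrite inE => /orP[/eqP->|js] Ajx; [left|right; exists j].
by move=> /(infinite_card_le_setU infS)[|/IH//]; exists i.
Qed.

(** The alternative [A x] serves the unexchanged pairs in [good_chain], which lie in no member of
    the chain. *)
Lemma bigcup_seq_chain (T : eqType) (F : set (set T)) (A : set T) (s : seq T) :
  total_on F subset -> F !=set0 ->
  (forall x, x \in s -> A x \/ exists2 X, F X & X x) ->
  exists2 X, F X & forall x, x \in s -> A x \/ X x.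
Proof.
move=> Ftot [X0 FX0]; elim: s => [_|x s IH sF]; first by exists X0.
have [X FX sX] : exists2 X, F X & forall y, y \in s -> A y \/ X y.
  by apply: IH => y ys; apply: sF; rewrite inE ys orbT.
have [Ax|[Y FY Yx]] := sF x (mem_head _ _).
  by exists X => // y; rewrite inE => /orP[/eqP->|/sX//]; left.
have [XY|YX] := Ftot _ _ FX FY.
  exists Y => // y; rewrite inE => /orP[/eqP->|/sX[Ay|/XY Yy]]; by [right|left].
by exists X => // y; rewrite inE => /orP[/eqP->|/sX//]; right; exact: YX.
Qed.

(** * Exchange of an independent family against a total set *)

Section Exchange.
Variables (k : fieldType) (I : eqType) (V : lmodType k).
Variables (D : set I) (g : I -> V) (T : set V).

Let dom (G : set (I * V)) : set I := [set i | exists v, G (i, v)].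

(** A pair [(i, v)] of [G] records that [g i] is replaced by [v]. The union of [G] and [rest G] is
    the family after the exchange, indexed by the pairs themselves. *)
Let rest (G : set (I * V)) : set (I * V) :=
  [set p | [/\ D p.1, ~ dom G p.1 & p.2 = g p.1]].

Let good (G : set (I * V)) : Prop :=
  [/\ forall p, G p -> D p.1 /\ T p.2,
      forall i v w, G (i, v) -> G (i, w) -> v = w
    & indep (G `|` rest G) (@snd I V)].

Let good_chain (F : set (set (I * V))) : indep D g ->
  F `<=` good -> total_on F subset -> good (\bigcup_(G in F) G).
Proof.
move=> indD Fgood Ftot; split.
- by move=> p [G /Fgood[GDT _ _] /GDT].
- move=> i v w [G FG Gv] [H FH Hw]; have [GH|HG] := Ftot _ _ FG FH.
    by have [_ Hf _] := Fgood _ FH; apply: Hf Hw; exact: GH.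
  by have [_ Gf _] := Fgood _ FG; apply: (Gf i) => //; exact: HG.
(* For the empty chain nothing is exchanged, and independence is that of [g]. Otherwise the finitely
   many exchanged pairs of a relation lie in one member [G], and the unexchanged ones remain in
   [rest G]. *)
have [F0|F0] := pselect (F !=set0); last first.
  move=> s c us sF s0.
  have sE p : p \in s -> D p.1 /\ p.2 = g p.1.
    by move=> /sF[[G FG _]|[]//]; case: F0; exists G.
  have inj1 : {in s &, injective (@fst I V)}.
    move=> [i v] [j w] /sE/= [_ ->] /sE/= [_ ->] ->; by [].
  have := @indD (map fst s) (fun i => c (i, g i)).
  rewrite map_inj_in_uniq// big_map.
  move=> /(_ us) indDs i si.
  have [Di iE] := sE _ si; rewrite (surjective_pairing i) iE.
  apply: indDs; last by apply: map_f.
    by move=> _ /= /mapP[p ps ->]; case: (sE _ ps).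
  rewrite -[RHS]s0; apply: eq_big_seq => -[j w] /sE/= [_ wE].
  by rewrite -wE.
move=> s c us sF.
have [|G FG sG] :=
    @bigcup_seq_chain _ F (rest (\bigcup_(G in F) G)) s Ftot F0.
  by move=> p /sF[[G FG Gp]|]; [right; exists G|left].
have [_ _ indG] := Fgood _ FG; apply: indG => // p /sG[[Dp ndp pE]|]; last by left.
by right; split=> // -[v Gv]; apply: ndp; exists v, G.
Qed.

(* A maximal partial exchange [G] of members [g i] against elements of [T]
   must be defined on all of [D]: a functional detecting the sole unexchanged
   [g i] is nonzero on some element of [T], which can then replace [g i]. *)
Lemma exchange_card : indep D g -> total T -> D #<= T.
Proof.
move=> indD totT.
have [G [[GDT Gf indG] maxG]] := Zorn_bigcup (fun F => @good_chain F indD).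
have Gtot i : D i -> dom G i.
  move=> Di; apply: contrapT => ndi.
  have resti : rest G (i, g i) by split.
  have [psi psiP] := indep_extend (fun p => (p == (i, g i))%:R) indG.
  have psi_i : psi (g i) = 1 by rewrite (psiP (i, g i)) ?eqxx//; right.
  have [t Tt psit] : exists2 t, T t & psi t != 0.
    apply: contrapT => nt.
    have /eqP : psi (g i) = 0.
      apply: totT => t Tt; have [//|nz] := eqVneq (psi t) 0.
      by case: nt; exists t.
    by rewrite psi_i oner_eq0.
  have nGi v : ~ G (i, v) by move=> Gv; apply: ndi; exists v.
  apply: (maxG (G `|` [set (i, t)])).
    split=> [p Gp|/(_ (i, t) (or_intror erefl))]; [by left|exact: nGi].
  split.
  - by move=> p [/GDT//|->].
  - move=> j v w [Gv|vE] [Gw|wE]; first exact: Gf Gv Gw.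
    + by case: (nGi v); case: wE => <-.
    + by case: (nGi w); case: vE => <-.
    + by case: vE wE => -> -> [].
  move=> s c us sG s0.
  have old p : p \in s -> p != (i, t) ->
      (G `|` rest G) p /\ p != (i, g i).
    move=> ps pit; have [[Gp|pE]|[Dp ndp pE]] := sG _ ps.
    - by split; [left|apply/negP => /eqP pE; apply: (nGi (g i)); rewrite -pE].
    - by rewrite pE eqxx in pit.
    - split.
        by right; split=> // -[v Gv]; apply: ndp; exists v; left.
      apply/negP => /eqP pE'; apply: ndp; exists t; right; by rewrite pE'.
  have psi0 p : p \in s -> p != (i, t) -> psi p.2 = 0.
    by move=> ps pit; have [Gp /negPf pi] := old p ps pit; rewrite psiP// pi.
  have [its|its] := boolP ((i, t) \in s); last first.
    apply: indG => // p ps; apply: (old p ps _).1.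
    by apply: contraNneq its => <-.
  (* The functional [psi] kills every other vector of the relation, leaving [c (i, t) * psi t]. *)
  have cit : c (i, t) = 0.
    have := congr1 psi s0; rewrite linear0 linear_sum (bigD1_seq (i, t))//=.
    rewrite big_seq_cond big1 ?addr0 => [|p /andP[ps pit]]; last first.
      by rewrite linearZ/= psi0 ?scaler0.
    by rewrite linearZ/= => /eqP; rewrite mulf_eq0 (negPf psit) orbF => /eqP.
  move: s0; rewrite (bigD1_seq (i, t))//= cit scale0r add0r -big_filter.
  move=> s0 p ps; have [->//|pit] := eqVneq p (i, t).
  apply: (indG [seq q <- s | q != (i, t)]) => //.
  + exact: filter_uniq.
  + by move=> q /=; rewrite mem_filter => /andP[qit qs]; case: (old q qs qit).
  + by rewrite mem_filter pit.
have /choice[f fP] i : exists v, D i -> G (i, v).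
  by have [/Gtot[v Gv]|nD] := pselect (D i); [exists v|exists 0].
apply: (@set_inj_card_le _ _ _ _ f) => [i Di|i j]; first by case: (GDT _ (fP _ Di)).
rewrite !inE => Di Dj fij; apply: contrapT => /eqP ij.
(* Distinct indices with the same image would give the relation [f i - f j = 0] between distinct
   pairs. *)
have := @indG [:: (i, f i); (j, f j)] (fun p => if p.1 == i then 1 else -1).
rewrite /= inE xpair_eqE (negPf ij) => /(_ erefl)/=.
rewrite !big_cons big_nil /= eqxx eq_sym (negPf ij) addr0 scale1r scaleN1r fij.
rewrite subrr => H; have /eqP : (if i == i then 1 else -1 : k) = 0.
  apply: (H _ erefl (i, f j)); last exact: mem_head.
  move=> p /=; rewrite !inE => /orP[]/eqP->; left; last exact: fP.
  by rewrite -fij; exact: fP.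
by rewrite eqxx oner_eq0.
Qed.

End Exchange.

(** * Codimension topologies are pairwise non-isomorphic *)

Section CommonKernel.
Variables (k : fieldType) (V : lmodType k).

(** Provides the subspace of codimension [K], kernels of single functionals and, with all
    functionals, the zero subspace. *)
Definition common_ker (Xi : set {linear V -> k^o}) : {pred V} :=
  fun v => `[< forall xi, Xi xi -> xi v = 0 >].

Lemma common_kerP (Xi : set {linear V -> k^o}) v :
  reflect (forall xi, Xi xi -> xi v = 0) (v \in common_ker Xi).
Proof. exact: asboolP. Qed.

Lemma common_ker_closed Xi : submod_closed (common_ker Xi).
Proof.
split=> [|a x y /common_kerP x0 /common_kerP y0]; apply/common_kerP => xi Xi_xi.
  exact: linear0.
by rewrite linearP/= x0// y0// scaler0 addr0.
Qed.
HB.instance Definition _ Xi := GRing.isSubmodClosed.Build k V (common_ker Xi)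
  (common_ker_closed Xi).

End CommonKernel.

(** Pulling functionals on the quotient back to [V] shows that the image of [T] is total there;
    exchange it against a basis. *)
Lemma dim_quot_le (k : fieldType) (V : lmodType k) (W : submodClosed V)
    (T : set V) :
  (forall xi : {linear V -> k^o}, (forall w, w \in W -> xi w = 0) ->
     (forall t, T t -> xi t = 0) -> forall v, xi v = 0) ->
  dim k (quot_space W) #<= T.
Proof.
move=> totT; apply: card_le_trans (card_image_le (\pi_(quot_space W)) T).
apply: (exchange_card (@dim_indep k _)) => xi xiT.
elim/quotW => v; have [p pE] := ex_linear (@pi_quot_linear k V W).
rewrite -pE; apply: (totT (xi \o p : {linear V -> k^o})) => [w wW|t Tt] /=.
  rewrite pE (_ : \pi_(quot_space W) w = \pi 0).
    by rewrite -pE !linear0.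
  by apply/pi_quotP; rewrite subr0.
by rewrite pE; apply: xiT; exists t.
Qed.

(** The [u j] stay independent in the product of the quotients, where bases of the factors together
    form a total set. Exchange embeds [D] in this finite union, so a single factor is large
    enough. *)
Lemma indep_mod_bigcap_card (k : fieldType) (X : topVectType k) (I : finType)
    (F : I -> submodClosed X) (J : eqType) (D : set J) (u : J -> X) :
  infinite_set D ->
  (forall (s : seq J) (c : J -> k), uniq s -> [set` s] `<=` D ->
     (forall i, \sum_(j <- s) c j *: u j \in F i) ->
     forall j, j \in s -> c j = 0) ->
  exists i, D #<= dim k (quot_space (F i)).
Proof.
move=> infD indD.
pose P := tv_prod (fun i => quot_space (F i) : topVectType k).
pose pr (x : X) : P := fun i => \pi_(quot_space (F i)) x.
have [p pE] : exists p : {linear X -> P}, p =1 pr.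
  apply: ex_linear => a x y; apply: functional_extensionality_dep => i.
  exact: pi_quot_linear.
pose d i (x : quot_space (F i)) : P := dfwith (0 : P) i x.
have dlin i : linear (@d i).
  move=> a x y; apply: functional_extensionality_dep => j.
  rewrite -[RHS]/(a *: d i x j + d i y j) /d.
  have [ij|ij] := eqVneq i j; first by case: _ / ij; rewrite !dfwithin.
  by rewrite !dfwithout// -[RHS]/(a *: 0 + 0) scaler0 addr0.
have [|i Di] := @infinite_card_le_bigcup _ _ I D
    (fun i => d i @` dim k (quot_space (F i))) infD.
  apply: (@exchange_card k J P D (p \o u)).
    move=> s c us sD s0; apply: indD => // i.
    rewrite -[X in X \in _]subr0; apply/pi_quotP.
    have pu0 : p (\sum_(j <- s) c j *: u j) = 0.
      by rewrite linear_sum -[RHS]s0; apply: eq_bigr => j _; rewrite linearZ.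
    have [q qE] := ex_linear (@pi_quot_linear k X (F i)).
    by rewrite -[LHS]/(pr _ i) -pE pu0 -qE linear0.
  move=> xi xi0 f.
  have -> : f = \sum_i d i (f i).
    apply: functional_extensionality_dep => i.
    have sumE (s : seq I) : (\sum_(j <- s) d j (f j)) i = \sum_(j <- s) d j (f j) i.
      by elim: s => [|j s IH]; rewrite ?big_nil// !big_cons -IH.
    rewrite sumE (bigD1 i)//= /d dfwithin big1 ?addr0// => j ji.
    by rewrite dfwithout.
  rewrite linear_sum big1// => i _.
  have [e eE] := ex_linear (@dlin i).
  rewrite -eE; apply: (@dim_total k _ (xi \o e : {linear _ -> k^o})) => b Bb /=.
  by rewrite eE; apply: xi0; exists i => //; exists b.
by exists i; apply: card_le_trans Di (card_image_le _ _).
Qed.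

(* [V] and [codim_space V K] carry the same module structure, but the two
   become convertible only once [V] is a constructor. *)
Lemma card_dim_codim_space (k : fieldType) (V : lmodType k) (K : Type)
    (W : submodClosed V) :
  dim k (@quot_space k (codim_space V K) W) #= dim k (quot_space W).
Proof. by case: V W => V ? W; exact: card_eqxx. Qed.

Lemma codim_space_no_bij (k : fieldType) (V : lmodType k) (K K' : Type)
    (f g : V -> V) :
  [set: nat] #<= [set: K] -> [set: K] #<= dim k V ->
  card_lt [set: K] [set: K'] ->
  linear f -> cancel g f ->
  continuous (f : codim_space V K -> codim_space V K') -> False.
Proof.
move=> infK Kdim [KK' K'K] fl gK fcts.
have [S SK SB] : exists2 S, S #= [set: K] & S `<=` dim k V by exact/card_subP.
(* The common kernel [W] is the span of the basis vectors outside [S], so [S] gives a basis of the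
   quotient. *)
pose Xi : set {linear V -> k^o} :=
  [set xi | forall b, dim k V b -> ~ S b -> xi b = 0].
pose W : submodClosed V := common_ker Xi.
have codimW : codim_lt W K'.
  have WK : dim k (quot_space W) #<= [set: K].
    rewrite -(card_le_eqr SK); apply: dim_quot_le => xi xiW xiS.
    apply: dim_total => b Bb; have [/xiS//|nSb] := pselect (S b).
    by apply: xiW; apply/common_kerP => zeta; exact.
  split; first exact: card_le_trans WK KK'.
  by move=> K'W; apply: K'K; exact: card_le_trans K'W WK.
have [f' fE] := ex_linear fl.
have nW : nbhs (0 : codim_space V K') [set w | w \in W].
  apply/gen_nbhsP; exists unit, (fun=> W); split=> // w /(_ tt).
  by rewrite add0r.
have f0 : f 0 = 0 by rewrite -fE linear0.
have /gen_nbhsP[I [F [codimF FW]]] :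
    nbhs (0 : codim_space V K) (f @^-1` [set w | w \in W]).
  by apply: fcts; rewrite f0.
have infS : infinite_set S.
  by apply/infiniteP; rewrite (card_le_eqr SK).
(* A combination of the [g v] lying in all [F i] is sent by [f] into [W]; the coordinate functional
   of each [v] in [S] belongs to [Xi], so its coefficient vanishes. *)
have [|i] := @indep_mod_bigcap_card k (codim_space V K) I F V S g infS.
  move=> s c us sS sF v vs.
  have /FW/common_kerP := sF; rewrite add0r.
  have -> : f (\sum_(v <- s) c v *: g v) = \sum_(v <- s) c v *: v.
    rewrite -fE linear_sum; apply: eq_bigr => w _.
    by rewrite linearZ/= fE gK.
  have [xi xiP] := indep_extend (fun w => (w == v)%:R) (@dim_indep k V).
  move=> /(_ xi) s0.
  have : xi (\sum_(v <- s) c v *: v) = 0.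
    apply: s0 => b Bb nSb; rewrite xiP//.
    by case: eqVneq => // bv; case: nSb; rewrite bv; exact: sS.
  rewrite linear_sum (bigD1_seq v)//= big_seq_cond big1 ?addr0 => [|w].
    by rewrite linearZ/= (xiP v) ?eqxx => [|]; [rewrite [_ *: _]mulr1|exact/SB/sS].
  move=> /andP[ws /negPf wv]; rewrite linearZ/= (xiP w) ?wv ?scaler0//.
  exact/SB/sS.
case: (codimF i) => _ nKF SF; apply: nKF.
by rewrite -(card_le_eql SK) -(card_le_eqr (card_dim_codim_space K (F i))).
Qed.

(** Otherwise [C] exceeds [A], and minimality of the successor puts [D] below [C]. Admissibility of
    the larger cardinal thus bounds the smaller one by the dimension. *)
Lemma card_lt_succ_le (T X Y : Type) (A : set T) (C : set X) (D : set Y) :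
  card_lt C D -> D #<= card_succ A -> C #<= A.
Proof.
move=> [CD nDC] DA; have [//|AC] := card_le_total C A.
have [//|nCA] := pselect (C #<= A).
have [_ succ_min] := card_succP A.
case: nDC; apply: card_le_trans DA _; exact: (succ_min X C).
Qed.

Lemma codim_space_not_iso (k : fieldType) (V : lmodType k) (K K' : Type) :
  card_admissible V K -> card_admissible V K' -> [set: K] #!= [set: K'] ->
  ~ tv_iso (codim_space V K) (codim_space V K').
Proof.
move=> [infK Ksucc] [infK' K'succ] neqK [f [g [fK gK fcts gcts]]].
have gl : linear (g : codim_space V K' -> codim_space V K).
  by move=> a x y; apply: (can_inj fK); rewrite gK (linearP f a (g x) (g y)) !gK.
have fl : linear (f : codim_space V K -> codim_space V K') by exact: linearP.
have [KK'|K'K] := card_le_total [set: K] [set: K'].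
  have ltK : card_lt [set: K] [set: K'].
    by split=> // K'K; move: neqK; rewrite card_eq_le KK' K'K.
  exact: (codim_space_no_bij infK (card_lt_succ_le ltK K'succ) ltK fl gK fcts).
have ltK : card_lt [set: K'] [set: K].
  by split=> // KK'; move: neqK; rewrite card_eq_le KK' K'K.
exact: (codim_space_no_bij infK' (card_lt_succ_le ltK Ksucc) ltK gl fK gcts).
Qed.

(** * Completions *)

Lemma codim_lt_nat (k : fieldType) (V : lmodType k) (W : submodClosed V)
    (K : Type) :
  [set: nat] #<= [set: K] -> codim_lt W nat -> codim_lt W K.
Proof.
move=> natK [Wnat natW]; split; first exact: card_le_trans Wnat natK.
by move=> KW; apply: natW; exact: card_le_trans natK KW.
Qed.

Lemma finite_codim_lt (k : fieldType) (V : lmodType k) (W : submodClosed V) :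
  finite_set (dim k (quot_space W)) <-> codim_lt W nat.
Proof.
split=> [finW|[_ /finite_setPn//]].
by split; [exact: finite_set_countable|exact/finite_setPn].
Qed.

Section Cofinite.
Variables (k : fieldType) (V : lmodType k) (K : Type).
Hypothesis infK : [set: nat] #<= [set: K].
Local Notation X := (codim_space V K).

Lemma codim_space_nbhs (W : submodClosed X) (x : X) (A : set X) :
  codim_lt W nat -> (forall w, w \in W -> A (x + w)) -> nbhs x A.
Proof.
move=> [Wnat natW] WA; apply/gen_nbhsP; exists unit, (fun=> W).
split=> [_|w /(_ tt)/WA//]; apply: codim_lt_nat => //.
have [XV VX] := iffLR (card_eqPle _ _) (@card_dim_codim_space k V K W).
split; first exact: card_le_trans VX Wnat.
by move=> natV; apply: natW; exact: card_le_trans natV VX.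
Qed.

Lemma codim_space_closed (W : submodClosed X) :
  codim_lt W nat -> closed [set x : X | x \in W].
Proof.
move=> cW; rewrite -[X in closed X]setCK; apply: open_closedC.
rewrite openE => x /= xW.
apply: (codim_space_nbhs cW) => w wW; apply: contra_not xW => xwW.
by rewrite -(addrK w x) -scaleN1r rpredD// rpredZ.
Qed.

Lemma quot_codim_space_open (W : submodClosed X) (A : set (quot_space W)) :
  codim_lt W nat -> open A.
Proof.
move=> cW; rewrite /open /= openE => x /= Ax.
apply: (codim_space_nbhs cW) => w wW.
rewrite /= (_ : \pi_(quot_space W) (x + w) = \pi x) //.
by apply/pi_quotP; rewrite addrC addKr.
Qed.

End Cofinite.

Section Completion.
Variables (k : fieldType) (V : lmodType k) (K K' : Type).
Hypotheses (infK : [set: nat] #<= [set: K]) (infK' : [set: nat] #<= [set: K']).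
Local Notation X := (codim_space V K).
Local Notation X' := (codim_space V K').

(* [X] and [X'] have the same closed subspaces of finite codimension, but the
   index types of their completion systems are not convertible. *)
Definition transfer_cofinite (W : closed_cofinite X') : closed_cofinite X :=
  exist _ (sval W) (conj (@codim_space_closed k V K infK _ (svalP W).2) (svalP W).2).

Definition transfer_family
    (f : tv_prod (@sys_obj k (completion_system X))) :
    tv_prod (@sys_obj k (completion_system X')) :=
  fun W => f (transfer_cofinite W).

Lemma transfer_compatible (f : profinite_completion X) :
  transfer_family (val f) \in submod_pred (@compatible k (completion_system X')).
Proof.
apply/asboolP => i j h; have /asboolP fc := valP f.
exact: (fc (transfer_cofinite i) (transfer_cofinite j) h).
Qed.

Definition transfer_completion (f : profinite_completion X) :
    profinite_completion X' :=
  Sub (transfer_family (val f)) (transfer_compatible f).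

Lemma transfer_completion_linear : linear transfer_completion.
Proof. by move=> a f g; apply: val_inj. Qed.

Lemma transfer_completion_continuous : continuous transfer_completion.
Proof.
apply: (@continuous_comp_initial _ _ _ val).
apply: tv_prod_continuous => W; apply/continuousP => A _.
(* The quotient topologies induced from [X] and [X'] are both discrete, so openness transfers for
   every [A]. *)
have oA : open (A : set (quot_space (sval (transfer_cofinite W)))).
  by exact: (@quot_codim_space_open k V K infK _ _ (svalP W).2).
have pc : continuous (fun f : profinite_completion X =>
    val f (transfer_cofinite W)).
  move=> f; apply: (@continuous_comp (profinite_completion X)
    (tv_prod (@sys_obj k (completion_system X))) _ val
    (fun f => f (transfer_cofinite W))).
    exact: initial_continuous.
  exact: tv_proj_continuous.
by have /continuousP/(_ _ oA) := pc.
Qed.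

End Completion.

Lemma transfer_completionK (k : fieldType) (V : lmodType k) (K K' : Type)
    (infK : [set: nat] #<= [set: K]) (infK' : [set: nat] #<= [set: K']) :
  cancel (@transfer_completion k V K K' infK)
         (@transfer_completion k V K' K infK').
Proof.
move=> f; apply: val_inj; apply: functional_extensionality_dep => -[W p].
rewrite /= /transfer_family /transfer_cofinite /=.
(* The round trip changes only the proof component of the index. *)
by congr (val f (exist _ _ _)); exact: Prop_irrelevance.
Qed.

Lemma profinite_completion_codim_space (k : fieldType) (V : lmodType k)
    (K K' : Type) :
  [set: nat] #<= [set: K] -> [set: nat] #<= [set: K'] ->
  tv_iso (profinite_completion (codim_space V K))
         (profinite_completion (codim_space V K')).
Proof.
move=> infK infK'.
have [F FE] := ex_linear (@transfer_completion_linear k V K K' infK).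
have FT : F = transfer_completion K' infK :> (_ -> _) by apply/funext.
exists F, (transfer_completion K infK'); rewrite FT; split.
- exact: transfer_completionK.
- exact: transfer_completionK.
- exact: transfer_completion_continuous.
- exact: transfer_completion_continuous.
Qed.

(** * Linear compactness and duals *)

(** Here [s] lists a basis and [xi b] is the coordinate functional of [b]; both sides agree on the
    basis. *)
Lemma finite_dual_basis (k : fieldType) (Y : lmodType k) :
  finite_set (dim k Y) ->
  exists (s : seq Y) (xi : Y -> {linear Y -> k^o}),
    forall (eta : {linear Y -> k^o}) y, eta y = \sum_(b <- s) eta b * xi b y.
Proof.
move=> /finite_seqP[s' sE'].
have [s us sE] : exists2 s, uniq s & dim k Y = [set` s].
  exists (undup s'); first exact: undup_uniq.
  by rewrite sE'; apply/seteqP; split=> x /=; rewrite mem_undup.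
have /choice[xi xiP] (b : Y) : exists xi : {linear Y -> k^o},
    forall b', dim k Y b' -> xi b' = (b' == b)%:R.
  exact: (indep_extend (fun b' => (b' == b)%:R) (@dim_indep k Y)).
exists s, xi => eta y; apply/eqP; rewrite -subr_eq0; apply/eqP.
pose d (y : Y) : k^o := eta y - \sum_(b <- s) eta b * xi b y.
have [D DE] : exists D : {linear Y -> k^o}, D =1 d.
  apply: ex_linear => a x z; rewrite /d linearP scalerBr -addrACA -opprD.
  congr (_ - _); rewrite scaler_sumr -big_split; apply: eq_bigr => b _ /=.
  by rewrite linearP mulrDr; congr (_ + _); exact: mulrCA.
rewrite -[LHS]/(d y) -DE; apply: dim_total => b Bb; rewrite DE /d.
have bs : b \in s by move: Bb; rewrite sE.
rewrite (bigD1_seq b)//= xiP// eqxx mulr1 big1 ?addr0 ?subrr// => b' bb'.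
by rewrite xiP// eq_sym (negPf bb') mulr0.
Qed.

(** Double duality, with coordinates [Theta (xi b)]. Taking [Theta] on all functions lets its
    linearity be stated on an existing module. *)
Lemma finite_reflexive (k : fieldType) (Y : lmodType k)
    (Theta : (Y -> k^o) -> k^o) :
  finite_set (dim k Y) -> linear Theta ->
  exists m : Y, forall eta : {linear Y -> k^o}, eta m = Theta eta.
Proof.
move=> /finite_dual_basis[s [xi xiP]] /ex_linear[T TE].
exists (\sum_(b <- s) Theta (xi b) *: b) => eta.
have etaE : (eta : Y -> k^o) = \sum_(b <- s) eta b *: (xi b : Y -> k^o).
  by apply/funext => y; rewrite xiP fct_sumE.
rewrite linear_sum [in RHS]etaE -TE linear_sum; apply: eq_bigr => b _.
by rewrite !linearZ/= TE [RHS]mulrC.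
Qed.

(** Vanishing on the kernel of [v] makes the pairs [(v x, eta x)] a functional graph. *)
Lemma extend_functional (k : fieldType) (X S : lmodType k)
    (v : {linear S -> X}) (eta : {linear S -> k^o}) :
  (forall x, v x = 0 -> eta x = 0) ->
  exists xi : {linear X -> k^o}, forall x, xi (v x) = eta x.
Proof.
move=> v0; pose G : set (X * k) := [set p | exists x, p = (v x, eta x)].
have [|xi xiP] := @functional_graph_extend k X G; last first.
  by exists xi => x; apply: (xiP (v x, eta x)); exists x.
split.
- by exists 0; rewrite !linear0.
- by move=> a _ _ _ _ [x [-> ->]] [y [-> ->]]; exists (a *: x + y); rewrite !linearP.
- by move=> a [x [/esym/v0 <- ->]].
Qed.

(** The property of codimension topologies that makes linear compactness equivalent to finite
    dimension; subspaces inherit it. *)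
Definition functionals_continuous (k : fieldType) (X : topVectType k) : Prop :=
  forall eta : {linear X -> k^o}, continuous (eta : X -> discrete_topology k).

Section FiniteDimensional.
Variables (k : fieldType) (X : topVectType k).

Lemma functional_ker_nbhs (eta : {linear X -> k^o}) :
  functionals_continuous X -> nbhs (0 : X) [set x | eta x = 0].
Proof.
move=> Xcts; apply: (Xcts eta 0 [set 0]).
by rewrite linear0 nbhs_principalE; exact/principal_filterP.
Qed.

(** The finitely many coordinate functionals have open kernels, which intersect in 0. *)
Lemma functionals_continuous_discrete :
  functionals_continuous X -> finite_set (dim k X) -> nbhs (0 : X) [set 0].
Proof.
move=> Xcts /finite_dual_basis[s [xi xiP]].
have : nbhs (0 : X) [set x | forall b, b \in s -> xi b x = 0].
  elim: s {xiP} => [|b s IH]; first by apply: filterS filterT => x _ b.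
  apply: filterS (filterI (functional_ker_nbhs (xi b) Xcts) IH).
  by move=> x [/= xb xs] c; rewrite inE => /orP[/eqP->|/xs].
apply: filterS => x x0 /=; apply/eqP; apply: contrapT => /negP/ex_separating[eta].
rewrite xiP big_seq big1 => [/eqP|b /x0->]; last exact: mulr0.
by rewrite eq_sym oner_eq0.
Qed.

Lemma add_const_continuous (w : X) : continuous (fun x : X => x + w).
Proof.
move=> x; apply: (@continuous2_cvg _ X X X _ _ id (cst w) (fun x y => x + y)).
- exact: (@tv_add_continuous k X (x, w)).
- exact: cvg_id.
- exact: cvg_cst.
Qed.

Lemma discrete_open (A : set X) : nbhs (0 : X) [set 0] -> open A.
Proof.
move=> n0; rewrite openE => x Ax.
have : nbhs x ((fun y => y - x) @^-1` [set 0]).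
  by apply: (@add_const_continuous (- x) x); rewrite /= subrr.
by apply: filterS => y /= /eqP; rewrite subr_eq0 => /eqP->.
Qed.

(** Such a space is the limit of the system with one index and itself as the only object. *)
Lemma discrete_linearly_compact :
  finite_set (dim k X) -> nbhs (0 : X) [set 0] -> linearly_compact X.
Proof.
move=> finX n0; split=> [A A0|].
  exists (common_ker (@setT {linear X -> k^o}) : submodClosed X).
  split; first exact: discrete_open.
  move=> x /common_kerP x0; suff -> : x = 0 by exact: nbhs_singleton A0.
  apply/eqP; apply: contrapT => /negP/ex_separating[xi].
  by rewrite x0// => /eqP; rewrite eq_sym oner_eq0.
have lin_id : linear (@id X) by [].
have cts_id : continuous (@id X) by move=> x; exact: cvg_id.
pose Sy : inverse_system k := @InverseSystem k unit (fun _ _ => True)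
  (fun _ => I) (fun _ _ _ _ _ => I) (fun _ => X) (fun _ _ _ => id)
  (fun _ _ _ => lin_id) (fun _ _ _ => cts_id) (fun _ _ _ => erefl)
  (fun _ _ _ _ _ _ _ => erefl).
exists Sy; split=> //; first by split; [exact: (inhabits tt)|move=> i j; exists tt].
  by move=> i A; exact: discrete_open.
pose const x : tv_prod (@sys_obj k Sy) := fun _ => x.
have constP x : const x \in submod_pred (@compatible k Sy) by apply/asboolP.
pose diag (x : X) : inverse_limit Sy := Sub (const x) (constP x).
have [f fE] : exists f : {linear X -> inverse_limit Sy}, f =1 diag.
  by apply: ex_linear => a x y; apply: val_inj.
have {fE} fE : f = diag :> (_ -> _) by apply/funext.
exists f, (fun z => val z tt); rewrite fE; split.
- by [].
- by move=> z; apply: val_inj; apply: functional_extensionality_dep => -[].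
- apply: (@continuous_comp_initial _ _ _ val).
  by apply: tv_prod_continuous => i; exact: cts_id.
- move=> z; apply: (@continuous_comp (inverse_limit Sy)
    (tv_prod (@sys_obj k Sy)) X val (fun h => h tt)).
    exact: initial_continuous.
  exact: tv_proj_continuous.
Qed.

End FiniteDimensional.

(** By directedness the kernels of the projections generate a filter on the product. It converges to
    0 in each coordinate, hence in the product. *)
Lemma inverse_limit_nbhs0 (k : fieldType) (S : inverse_system k)
    (A : set (inverse_limit S)) :
  is_directed S -> nbhs (0 : inverse_limit S) A ->
  exists i, forall z : inverse_limit S, val z i = 0 -> A z.
Proof.
move=> [[i0] dir]; pose P := tv_prod (@sys_obj k S).
pose F : set_system P :=
  [set B | exists i, forall z : inverse_limit S, val z i = 0 -> B (val z)].
have map0 i j (h : @sys_le k S i j) : sys_map h 0 = 0.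
  by have [m mE] := ex_linear (sys_map_linear h); rewrite -mE linear0.
have FF : Filter F.
  split.
  - by exists i0.
  - move=> B C [i iB] [j jC]; have [l [il jl]] := dir i j; exists l => z zl.
    have /asboolP zc := valP z.
    by split; [apply: iB; rewrite -(zc _ _ il)|apply: jC; rewrite -(zc _ _ jl)];
      rewrite zl map0.
  - by move=> B C BC [i iB]; exists i => z /iB/BC.
have F0 : F --> (0 : P).
  apply/cvg_sup => i U [_ [[B oB <-] B0]] /filterS; apply.
  by exists i => z zi; rewrite /= zi; exact: B0.
rewrite nbhsE => -[_ [[B oB <-] B0] BA].
have /F0[i iB] : nbhs (0 : P) B by apply: open_nbhs_nbhs.
by exists i => z /iB/BA.
Qed.

(* An inverse limit on which all functionals are continuous is algebraically
   reflexive: a functional [xi] on functionals yields a compatible family [m],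
   hence a vector at which every functional takes the value given by [xi].
   But if the [e n] are infinitely many basis vectors, no vector has all
   coordinates [phi n] equal to 1. *)
Lemma linearly_compact_finite_dim (k : fieldType) (X : topVectType k) :
  functionals_continuous X -> linearly_compact X -> finite_set (dim k X).
Proof.
move=> Xcts [_ [S [dirS finS _ [psi [chi [psiK chiK _ chi_cts]]]]]].
apply: contrapT => /infiniteP/(card_le_set_inj (0 : X))[e eB einj].
have {}einj : injective e by move=> i j; apply: einj; rewrite inE.
have {}eB n : dim k X (e n) by exact: eB.
pose pr i x := val (psi x) i.
have /all_tag[p pE] : forall i, {p : {linear X -> sys_obj i} | p =1 pr i}.
  by move=> i; apply: cid; apply: ex_linear => a x y; rewrite /pr linearP.
(* By continuity [phi] vanishes on the kernel of some projection, so it factors through it. *)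
have factor (phi : {linear X -> k^o}) : exists i (eta : {linear sys_obj i -> k^o}),
    forall x, eta (pr i x) = phi x.
  have n0 : nbhs (0 : inverse_limit S) [set z | phi (chi z) = 0].
    apply: (chi_cts 0 [set x | phi x = 0]); rewrite -(linear0 psi) psiK.
    exact: functional_ker_nbhs.
  have [i i0] := inverse_limit_nbhs0 dirS n0.
  have [x|eta etaE] := @extend_functional k _ _ (p i) phi.
    by rewrite pE => /i0; rewrite /= psiK.
  by exists i, eta => x; rewrite -pE.
have /choice[phi phiP] n : exists phi : {linear X -> k^o},
    forall b, dim k X b -> phi b = (b == e n)%:R.
  exact: (indep_extend (fun b => (b == e n)%:R) (@dim_indep k X)).
have [|xi xi1] :=
    @indep_extend k nat (X -> k^o) setT (fun n => phi n) (fun=> 1).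
  move=> s c us _ s0 n ns; have := congr1 (fun f : X -> k^o => f (e n)) s0.
  rewrite fct_sumE (bigD1_seq n)//= big1 ?addr0 => [|m mn].
    rewrite -[LHS]/(c n * phi n (e n)) phiP// eqxx mulr1; exact.
  rewrite -[LHS]/(c m * phi m (e n)) phiP// (inj_eq einj) eq_sym (negPf mn).
  exact: mulr0.
(* Pulling back along [pr i] turns [xi] into a functional on the dual of [sys_obj i], which a vector
   represents by finite dimension. *)
have /all_tag[m mP] : forall i, {m : sys_obj i |
    forall eta : {linear sys_obj i -> k^o}, eta m = xi (eta \o pr i)}.
  move=> i; apply: cid; apply: (finite_reflexive (Theta := fun f => xi (f \o pr i))) => //.
  by move=> a f g; rewrite -linearP.
have map_pr i j (h : @sys_le k S i j) x : sys_map h (pr j x) = pr i x.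
  by have /asboolP := valP (psi x); exact.
(* Functionals separate points, and [eta] after the transition map pulls back to the same functional
   on [X] as [eta] on the target. *)
have mc : (m : tv_prod (@sys_obj k S)) \in submod_pred (@compatible k S).
  apply/asboolP => i j h; apply/eqP; rewrite -subr_eq0; apply: contrapT.
  move=> /negP/ex_separating[eta]; have [f fE] := ex_linear (sys_map_linear h).
  rewrite linearB -fE/= -[eta (f _)]/((eta \o f) (m j)) !mP.
  rewrite (_ : (eta \o f) \o pr j = eta \o pr i).
    by rewrite subrr => /eqP; rewrite eq_sym oner_eq0.
  by apply/funext => x /=; rewrite fE map_pr.
pose x0 := chi (Sub (m : tv_prod (@sys_obj k S)) mc).
have phi_x0 n : phi n x0 = 1.
  have [i [eta etaE]] := factor (phi n).
  rewrite -etaE /pr /x0 chiK /= mP -(xi1 n Logic.I); congr (xi _).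
  by apply/funext => x /=; rewrite etaE.
have [s [c [sB x0E]]] := (dimP X).2 x0.
(* If [e n] were absent from the finite expansion of [x0], then [phi n x0] would be 0, not 1. *)
have es n : e n \in s.
  apply: contrapT => nes; have := phi_x0 n.
  rewrite x0E linear_sum big_seq big1 => [/eqP|w ws].
    by rewrite eq_sym oner_eq0.
  rewrite linearZ/= phiP; last exact: sB.
  by case: eqP => [wE|_]; [case: nes; rewrite -wE|exact: scaler0].
apply: infinite_nat; apply: (card_le_finite _ (finite_seq s)).
by apply: (@set_inj_card_le _ _ _ _ e) => [i _|i j _ _]; [exact: es|exact: einj].
Qed.

(** * Functionals and linearly compact subspaces of codimension topologies *)

Section DualCodimSpace.
Variables (k : fieldType) (V : lmodType k) (K : Type).
Hypothesis infK : [set: nat] #<= [set: K].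
Local Notation X := (codim_space V K).

Lemma codim_space_functionals_continuous : functionals_continuous X.
Proof.
move=> phi x A /= /(@nbhs_singleton (discrete_topology k) (phi x)) Ax.
pose W : submodClosed X := common_ker [set phi].
have cW : codim_lt W nat.
  (* The quotient by the kernel is spanned by any [v0] with [phi v0] nonzero, or by 0 when [phi] is
     zero. *)
  apply/finite_codim_lt; have [v0 v0P] : exists v0, forall v : X,
      exists a, phi v = a * phi v0.
    have [[v0 /eqP v00]|n0] := pselect (exists v, phi v <> 0).
      by exists v0 => v; exists (phi v / phi v0); rewrite divfK.
    exists 0 => v; exists 0; rewrite mul0r; apply: contrapT => v0.
    by apply: n0; exists v.
  apply: (card_le_finite _ (finite_set1 v0)).
  apply: dim_quot_le => xi xiW xi0 v; have [a va] := v0P v.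
  rewrite -(subrK (a *: v0) v) linearD [xi (a *: v0)]linearZ/= (xi0 v0)// scaler0 addr0.
  apply: xiW; apply/common_kerP => _ ->.
  by rewrite linearB [phi (a *: v0)]linearZ/= va subrr.
apply: (@codim_space_nbhs k V K infK W) => // w /common_kerP/(_ phi erefl) w0.
by rewrite /= linearD w0 addr0.
Qed.

Lemma linearly_compact_codim_space (L : submodClosed X) :
  linearly_compact (subspace_of L) <-> finite_set (dim k (subspace_of L)).
Proof.
have [v vE] : exists v : {linear subspace_of L -> X}, v =1 val.
  by apply: ex_linear => a x y.
(* A functional on [L] extends to [X], where it is continuous. *)
have Lcts : functionals_continuous (subspace_of L).
  move=> eta; have [x|xi xiE] := @extend_functional k _ _ v eta.
    by rewrite vE => x0; rewrite (_ : x = 0) ?linear0//; exact: val_inj.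
  have -> : (eta : subspace_of L -> discrete_topology k) = xi \o val.
    by apply/funext => x /=; rewrite -vE xiE.
  move=> x; apply: (@continuous_comp (subspace_of L) X (discrete_topology k)).
    exact: initial_continuous.
  exact: codim_space_functionals_continuous.
split; first exact: linearly_compact_finite_dim.
move=> finL; apply: discrete_linearly_compact => //.
exact: functionals_continuous_discrete.
Qed.

Lemma mem_codim_space_dual (f : X -> k^o) :
  linear f -> f \in submod_pred (@continuous_dual_pred k X).
Proof.
move=> fl; apply/asboolP; split=> //.
have [F FE] := ex_linear fl.
rewrite (_ : f = F); last by apply/funext => x; rewrite FE.
exact: codim_space_functionals_continuous.
Qed.

End DualCodimSpace.

Section DualTransfer.
Variables (k : fieldType) (V : lmodType k) (K K' : Type).
Hypotheses (infK : [set: nat] #<= [set: K]) (infK' : [set: nat] #<= [set: K']).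
Local Notation X := (codim_space V K).
Local Notation X' := (codim_space V K').

Lemma transfer_functional_mem (f : dual X) :
  (val f : X' -> k^o) \in submod_pred (@continuous_dual_pred k X').
Proof.
apply: (@mem_codim_space_dual k V K' infK').
by have /asboolP[] := valP f.
Qed.

Definition transfer_functional (f : dual X) : dual X' :=
  Sub (val f : X' -> k^o) (transfer_functional_mem f).

Lemma transfer_functional_linear : linear transfer_functional.
Proof. by move=> a f g; apply: val_inj. Qed.

(** Linear compactness of [L] means finite dimension in both topologies, so the same annihilators
    generate the two dual topologies. *)
Lemma transfer_functional_continuous : continuous transfer_functional.
Proof.
move=> f A /gen_nbhsP[I [F [FP FA]]].
have /choice[L LP] i : exists L : submodClosed X',
    linearly_compact (subspace_of L) /\ perp L = F i :> submodClosed _.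
  by have [L Lc LE] := FP i; exists L.
apply/gen_nbhsP; exists I, (fun i =>
  perp (L i : submodClosed X) : submodClosed (continuous_dual X)).
split=> [i|g gL].
  exists (L i) => //; have [Lc _] := LP i.
  apply/(@linearly_compact_codim_space k V K infK).
  exact: (iffLR (@linearly_compact_codim_space k V K' infK' (L i)) Lc).
rewrite /= (_ : transfer_functional (f + g) =
  transfer_functional f + transfer_functional g); last exact: val_inj.
apply: FA => i; have [_ <-] := LP i.
by apply/asboolP => x xL; have /asboolP := gL i; exact.
Qed.

End DualTransfer.

Lemma dual_codim_space (k : fieldType) (V : lmodType k) (K K' : Type) :
  [set: nat] #<= [set: K] -> [set: nat] #<= [set: K'] ->
  tv_iso (dual (codim_space V K)) (dual (codim_space V K')).
Proof.
move=> infK infK'.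
have [F FE] := ex_linear (@transfer_functional_linear k V K K' infK').
have FT : F = transfer_functional infK' :> (_ -> _) by apply/funext.
exists F, (@transfer_functional k V K' K infK); rewrite FT; split.
- by move=> f; apply: val_inj.
- by move=> f; apply: val_inj.
- exact: transfer_functional_continuous.
- exact: transfer_functional_continuous.
Qed.

Theorem proposition3p11 (k : fieldType) (V : lmodType k) :
  [/\ forall K K' : Type, card_admissible V K -> card_admissible V K' ->
        [set: K] #!= [set: K'] ->
        ~ tv_iso (codim_space V K) (codim_space V K'),
      forall K K' : Type, card_admissible V K -> card_admissible V K' ->
        tv_iso (profinite_completion (codim_space V K))
               (profinite_completion (codim_space V K'))
    & forall K K' : Type, card_admissible V K -> card_admissible V K' ->
        tv_iso (dual (codim_space V K)) (dual (codim_space V K'))].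
Proof.
split=> K K' [infK Ksucc] [infK' K'succ].
- exact: codim_space_not_iso.
- exact: profinite_completion_codim_space.
- exact: dual_codim_space.
Qed.
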